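(* Let $p$ be a prime, let $P(X)\in\mathbb{Z}_p[[X]]$ be a power series with $P(0)=0$ and $P(X)\equiv X^p \pmod{p\mathbb{Z}_p[[X]]}$, and let $\boldsymbol{\varpi}=(\varpi_j)_{j\ge 0}$ be a sequence in $\mathbb{Q}_p^{\mathrm{alg}}$ with $|\varpi_j|<1$, $P(\varpi_0)=0$ and $P(\varpi_{j+1})=\varpi_j$ for all $j\ge 0$. For $m\geq 0$ let $[\varpi_m]\in \mathbf{W}(\mathbb{Z}_p[\varpi_m])$ be the unique Witt vector whose phantom (ghost) vector is $\langle\varpi_m,\varpi_{m-1},\ldots,\varpi_0,0,0,\ldots\rangle$, and let $$E_m(T):=E([\varpi_m],T)=\exp\Bigl(\varpi_mT+\varpi_{m-1}\frac{T^p}{p}+\cdots+\varpi_0\frac{T^{p^m}}{p^m}\Bigr).$$ Then the following are equivalent: (i) for every $m\ge 0$ the series $E_m(T)$ converges exactly in the disk $|T|<1$ (i.e. its radius of convergence is $1$ and it does not converge in any larger disk); (ii) $P(X)$ is a Lubin-Tate series and $\boldsymbol{\varpi}$ is a generator of the Tate module $\mathrm{T}(\mathfrak{G}_P)$.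
   Context: $|.|$ is the $p$-adic absolute value on $\mathbb{Q}_p^{\mathrm{alg}}$. For a ring $B$, the phantom vector of $\boldsymbol\lambda=(\lambda_0,\lambda_1,\dots)\in\mathbf{W}(B)$ is $\langle\phi_0,\phi_1,\ldots\rangle$ with $\phi_n=\lambda_0^{p^n}+p\lambda_1^{p^{n-1}}+\cdots+p^n\lambda_n$. The Artin-Hasse exponential attached to $\boldsymbol\lambda$ (for $B$ a $\mathbb{Z}_{(p)}$-algebra) is $E(\boldsymbol\lambda,T)=\prod_{j\ge0}E(\lambda_jT^{p^j})$, where $E(T)=\exp(T+T^p/p+T^{p^2}/p^2+\cdots)\in 1+T\mathbb{Z}_{(p)}[[T]]$; it equals $\exp(\phi_0T+\phi_1T^p/p+\phi_2T^{p^2}/p^2+\cdots)$. A Lubin-Tate series (over $\mathbb{Z}_p$) is a series $P(X)\in\mathbb{Z}_p[[X]]$ such that, for some uniformizer $\mathrm{w}$ of $\mathbb{Z}_p$ (i.e. $|\mathrm{w}|=|p|$), $P(X)\equiv \mathrm{w}X \pmod{X^2\mathbb{Z}_p[[X]]}$ and $P(X)\equiv X^p\pmod{\mathrm{w}\mathbb{Z}_p[[X]]}$. In this case $\mathfrak{G}_P$ denotes the unique (Lubin-Tate) formal group law over $\mathbb{Z}_p$ having $P$ as an endomorphism. A generator of its Tate module $\mathrm{T}(\mathfrak{G}_P)$ is a sequence $(\pi_j)_{j\ge0}$ in the open unit disk of $\mathbb{Q}_p^{\mathrm{alg}}$ with $P(\pi_0)=0$, $\pi_0\ne0$, and $P(\pi_{j+1})=\pi_j$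 for all $j\ge0$. *)

(* Defs.v *)
From mathcomp Require Import all_boot all_order all_algebra.
From mathcomp Require Import all_classical all_reals all_analysis.

Set Implicit Arguments.
Unset Strict Implicit.
Unset Printing Implicit Defensive.

Import Order.TTheory GRing.Theory Num.Theory.
Import numFieldNormedType.Exports.

Local Open Scope classical_set_scope.
Local Open Scope ring_scope.

Section AbsoluteValue.
Variables (R : realType) (K : closedFieldType) (abs : K -> R).

Definition abs_cvg (u : nat -> K) (l : K) : Prop :=
  (fun n => abs (u n - l)) @ \oo --> (0 : R).

Definition abs_cauchy (u : nat -> K) : Prop :=
  forall e : R, 0 < e ->
    exists N : nat, forall m n : nat, (N <= m)%N -> (N <= n)%N ->
      abs (u m - u n) < e.

(* The topological closure of the prime field; when [K] is an algebraic
   closure of Q_p (see [Qp_alg] below) this is Q_p. *)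
Definition Qp : set K :=
  [set x | exists q : nat -> rat, abs_cvg (fun n => ratr (q n)) x].

Definition Zp : set K := [set x | Qp x /\ abs x <= 1].

(* [K], with [abs], is an algebraic closure of Q_p with its p-adic absolute
   value: [abs] is a non-archimedean absolute value inducing the p-adic one
   on Q (hence K has characteristic 0), the closure [Qp] of Q in K is a
   completion of Q, and the algebraically closed field K is algebraic over
   [Qp].  This determines (K, abs) up to isometric isomorphism. *)
Record Qp_alg (p : nat) : Prop := {
  Qp_alg_abs_eq0 : forall x : K, abs x = 0 <-> x = 0;
  Qp_alg_absM : forall x y : K, abs (x * y) = abs x * abs y;
  Qp_alg_absD : forall x y : K, abs (x + y) <= Num.max (abs x) (abs y);
  Qp_alg_abs_nat : forall n : nat, (0 < n)%N ->
    abs n%:R = (p%:R : R) ^- logn p n;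
  Qp_alg_complete : forall q : nat -> rat,
    abs_cauchy (fun n => ratr (q n)) ->
    exists x : K, abs_cvg (fun n => ratr (q n)) x;
  Qp_alg_algebraic : forall x : K, exists f : {poly K},
    [/\ f != 0, forall i : nat, Qp f`_i & root f x]
}.

(* The ring Z_p[a]. *)
Definition Zp_adjoin (a : K) : set K :=
  [set x | exists2 f : {poly K}, forall i : nat, Zp f`_i & x = f.[a]].

End AbsoluteValue.

(* [f : fps K] stands for the formal power series sum_n f n T^n. *)
Definition fps (K : Type) : Type := nat -> K.

Section FormalPowerSeries.
Variable K : fieldType.

Definition fps_one : fps K := fun n => (n == 0)%N%:R.

Definition fps_Xn (k : nat) : fps K := fun n => (n == k)%N%:R.

Definition fps_mul (f g : fps K) : fps K :=
  fun n => \sum_(i < n.+1) f i * g (n - i)%N.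

Definition fps_exp (f : fps K) (k : nat) : fps K := iter k (fps_mul f) fps_one.

(* exp(f) = sum_k f^k / k!, for f without constant term: then f^k has order
   at least k, so that the terms k > n do not contribute to degree n. *)
Definition fps_expo (f : fps K) : fps K :=
  fun n => \sum_(k < n.+1) fps_exp f k n / k`!%:R.

(* f(a T^d), for d > 0 *)
Definition fps_comp_monomial (f : fps K) (a : K) (d : nat) : fps K :=
  fun n => if (d %| n)%N then f (n %/ d)%N * a ^+ (n %/ d) else 0.

(* prod_(j >= 0) F j, for F j in 1 + T^j K[[T]] with F j = 1 modulo T^(n+1)
   for all j > n: the factors j > n do not contribute to degree n. *)
Definition fps_prod (F : nat -> fps K) : fps K :=
  fun n => foldr (fun j => fps_mul (F j)) fps_one (iota 0 n.+1) n.

Variable p : nat.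

(* sum_i phi_i T^(p^i) / p^i (for p > 1, p^i = n forces i <= n) *)
Definition phantom_series (phi : nat -> K) : fps K :=
  fun n => \sum_(i < n.+1 | (p ^ i == n)%N) phi i / (p ^ i)%:R.

(* The Artin-Hasse series exp(T + T^p/p + T^(p^2)/p^2 + ...) *)
Definition artin_hasse : fps K := fps_expo (phantom_series (fun=> 1)).

(* A Witt vector over a subring B of K is a sequence of elements of B. *)
Definition witt_phantom (lambda : nat -> K) : nat -> K :=
  fun n => \sum_(i < n.+1) p%:R ^+ i * lambda i ^+ (p ^ (n - i)).

(* E(lambda, T) = prod_j E(lambda_j T^(p^j)) *)
Definition artin_hasse_exp (lambda : nat -> K) : fps K :=
  fps_prod (fun j => fps_comp_monomial artin_hasse (lambda j) (p ^ j)).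

(* <varpi_m, varpi_(m-1), ..., varpi_0, 0, 0, ...> *)
Definition phantom_of_seq (varpi : nat -> K) (m : nat) : nat -> K :=
  fun n => if (n <= m)%N then varpi (m - n)%N else 0.

End FormalPowerSeries.

Section Analytic.
Variables (R : realType) (K : closedFieldType) (abs : K -> R).

(* f converges at t, with sum y; K is not complete, so convergence to a
   given element of K is part of the assertion f(t) = y. *)
Definition fps_sum (f : fps K) (t y : K) : Prop :=
  abs_cvg abs (fun n => \sum_(i < n) f i * t ^+ i) y.

Definition converges_at (f : fps K) (t : K) : Prop := exists y, fps_sum f t y.

Definition radius_of_convergence (f : fps K) : \bar R :=
  ereal_sup [set (abs t)%:E | t in [set t | converges_at f t]].

Definition open_disk (r : R) : set K := [set t | abs t < r].
Definition closed_disk (r : R) : set K := [set t | abs t <= r].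

Definition is_disk (D : set K) : Prop :=
  exists r : R, D = open_disk r \/ D = closed_disk r.

(* The closed disk |T| <= 1 counts as a larger disk. *)
Definition converges_exactly_in_open_unit_disk (f : fps K) : Prop :=
  [/\ forall t, open_disk 1 t -> converges_at f t,
      radius_of_convergence f = 1%:E
    & forall D : set K, is_disk D -> open_disk 1 `<` D ->
        ~ (forall t, D t -> converges_at f t)].

Definition integral_fps (f : fps K) : Prop := forall n, Zp abs (f n).

(* f = g modulo w Z_p[[X]] *)
Definition fps_eqmod (w : K) (f g : fps K) : Prop :=
  exists2 h : fps K, integral_fps h & forall n, f n - g n = w * h n.

Variable p : nat.

(* For P in Z_p[[X]], P = w X modulo X^2 Z_p[[X]] says P_0 = 0 and P_1 = w. *)
Definition lubin_tate_series (P : fps K) : Prop :=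
  integral_fps P /\
  exists w : K, [/\ Zp abs w, abs w = abs p%:R,
                    P 0%N = 0 /\ P 1%N = w
                  & fps_eqmod w P (fps_Xn K p)].

(* pi generates the Tate module of the Lubin-Tate group attached to P. *)
Definition tate_generator (P : fps K) (pi : nat -> K) : Prop :=
  [/\ forall j, abs (pi j) < 1,
      fps_sum P (pi 0%N) 0,
      pi 0%N <> 0
    & forall j, fps_sum P (pi j.+1) (pi j)].

(* lambda is a Witt vector over Z_p[varpi_m] with phantom vector
   <varpi_m, ..., varpi_0, 0, 0, ...>. *)
Definition witt_bracket (varpi : nat -> K) (m : nat) (lambda : nat -> K) :
  Prop :=
  (forall j, Zp_adjoin abs (varpi m) (lambda j)) /\
  (forall n, witt_phantom p lambda n = phantom_of_seq varpi m n).

End Analytic.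

(* Main.v *)
(* The components [phi_n] of the phantom vector at hand are the values at [varpi_m]
   of the iterates of [P].  As [P] lifts Frobenius, Dwork's lemma in Z_p[X] makes
   the sequence of iterates the phantom vector of a Witt vector, to be specialised
   at [X = varpi_m]; replacing [P] by a truncation changes phantom components only
   by multiples of a high power of [p] in Z_p[varpi_m], so power series are not
   needed here.  Hence [E_m] has coefficients in the unit ball of the complete
   field Q_p(varpi_m), and it converges exactly in the open unit disk if and only
   if its coefficients do not tend to 0.

   Since [E_(m+1)(T)^p = exp(p varpi_(m+1) T) E_m(T^p)], where the exponential
   converges beyond the closed unit disk, coefficients tending to 0 for some [m]
   also tend to 0 for [m = 0].  Now [E_0 = exp(varpi_0 T)] converges exactly in the
   open unit disk if and only if [|varpi_0|^(p-1) = |p|] (given that the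
   coefficients are bounded by 1).  The equation [P(varpi_0) = 0] gives
   [|P_1 + varpi_0^(p-1)| < |p|] when [varpi_0 <> 0], so this amounts to
   [|P_1| = |p|], that is, to [P] being a Lubin-Tate series. *)
Require Import Defs.
From mathcomp Require Import all_boot all_order all_algebra.
From mathcomp Require Import all_classical all_reals all_analysis.
From mathcomp Require Import ring lra zify.
From HB Require Import structures.

Set Implicit Arguments.
Unset Strict Implicit.
Unset Printing Implicit Defensive.

Import Order.TTheory GRing.Theory Num.Theory.
Import numFieldNormedType.Exports.
Local Open Scope ring_scope.

(** * The ring of formal power series and its exponential *)

Section FpsRing.
Variable K : fieldType.
Implicit Types f g h : fps K.

(** Coefficients of a product up to degree [n] depend only on truncations, so associativity,
    commutativity and the Leibniz rule are inherited from [{poly K}]. *)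
Definition fps_trunc (n : nat) f : {poly K} := \poly_(i < n.+1) f i.

Lemma coef_fps_trunc n f i : (i <= n)%N -> (fps_trunc n f)`_i = f i.
Proof. by move=> le_in; rewrite coef_poly ltnS le_in. Qed.

Lemma fps_mul_trunc n f g i : (i <= n)%N ->
  fps_mul f g i = (fps_trunc n f * fps_trunc n g)`_i.
Proof.
move=> le_in; rewrite coefM; apply: eq_bigr => j _.
rewrite !coef_fps_trunc ?(leq_trans (leq_subr _ _)) //.
by rewrite (leq_trans _ le_in) // -ltnS.
Qed.

Lemma fps_mulC : commutative (@fps_mul K).
Proof.
by move=> f g; apply/funext => n; rewrite !(fps_mul_trunc _ _ (leqnn n)) mulrC.
Qed.

Lemma fps_mulA : associative (@fps_mul K).
Proof.
move=> f g h; apply/funext => n.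
transitivity (fps_trunc n f * fps_trunc n g * fps_trunc n h)`_n.
  rewrite -mulrA coefM; apply: eq_bigr => j _.
  rewrite coef_fps_trunc -1?ltnS // -fps_mul_trunc //; exact: leq_subr.
rewrite coefM; apply: eq_bigr => j _.
rewrite -fps_mul_trunc -1?ltnS // coef_fps_trunc //; exact: leq_subr.
Qed.

Lemma fps_mul1 : left_id (@fps_one K) (@fps_mul K).
Proof.
move=> f; apply/funext => n; rewrite /fps_mul big_ord_recl /= subn0.
by rewrite /fps_one eqxx mul1r big1 ?addr0 // => i _; rewrite mul0r.
Qed.

HB.instance Definition _ := GRing.Zmodule.copy (fps K) (nat -> K).

Lemma fps_mulDl : left_distributive (@fps_mul K) +%R.
Proof.
move=> f g h; apply/funext => n; rewrite /fps_mul -[RHS]big_split /=.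
by apply: eq_bigr => i _; rewrite -mulrDl.
Qed.

Lemma fps_one_neq0 : @fps_one K != 0.
Proof. by apply/eqP => /(congr1 (@^~ 0%N))/eqP; rewrite /fps_one oner_eq0. Qed.

HB.instance Definition _ := GRing.Zmodule_isComNzRing.Build (fps K)
  fps_mulA fps_mulC fps_mul1 fps_mulDl fps_one_neq0.

Lemma fps_mulE f g n : (f * g) n = \sum_(i < n.+1) f i * g (n - i)%N.
Proof. by []. Qed.

Lemma fps_oneE n : (1 : fps K) n = (n == 0)%N%:R.
Proof. by []. Qed.

Lemma fps_expE f k : fps_exp f k = f ^+ k.
Proof. by elim: k => [|k IHk] //; rewrite exprS -IHk. Qed.

Lemma fps_addE f g n : (f + g) n = f n + g n. Proof. by []. Qed.
Lemma fps_oppE f n : (- f) n = - f n. Proof. by []. Qed.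
Lemma fps_sumE (I : Type) (r : seq I) (Q : pred I) (F : I -> fps K) n :
  (\sum_(i <- r | Q i) F i) n = \sum_(i <- r | Q i) F i n.
Proof. by elim/big_rec2: _ => //= i x y _ <-. Qed.

Lemma fps_mulrnE f k n : (f *+ k) n = f n *+ k.
Proof. by elim: k => [|k IHk]; rewrite ?mulr0n // !mulrS fps_addE IHk. Qed.

Lemma fps_coef0M f g : (f * g) 0%N = f 0%N * g 0%N.
Proof. by rewrite fps_mulE big_ord1. Qed.

Lemma fps_coef0X f k : (f ^+ k) 0%N = f 0%N ^+ k.
Proof. by elim: k => [|k IHk] //; rewrite !exprS fps_coef0M IHk. Qed.

Lemma fps_prodE (F : nat -> fps K) n : fps_prod F n = (\prod_(j < n.+1) F j) n.
Proof.
rewrite -(big_mkord predT) /index_iota subn0 /fps_prod.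
congr (_ n); elim: (iota _ _) => [|j s IHs]; first by rewrite big_nil.
by rewrite big_cons -IHs.
Qed.

Lemma fps_mul_order f g n : (forall i, (i < n)%N -> f i = 0) ->
  (f * g) n = f n * g 0%N.
Proof.
move=> f_ord; rewrite fps_mulE big_ord_recr /= subnn big1 ?add0r // => i _.
by rewrite f_ord ?mul0r.
Qed.

Lemma fps_exp_order f k n : f 0%N = 0 -> (n < k)%N -> (f ^+ k) n = 0.
Proof.
move=> f0; elim: k n => // k IHk n; rewrite ltnS => le_nk.
rewrite exprS fps_mulE big1 // => -[[|i] /= lt_in] _; first by rewrite f0 mul0r.
rewrite IHk ?mulr0 //; lia.
Qed.

Lemma fps_mul_eq f g f' g' n : (forall i, (i <= n)%N -> f i = f' i) ->
    (forall i, (i <= n)%N -> g i = g' i) ->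
  forall i, (i <= n)%N -> (f * g) i = (f' * g') i.
Proof.
move=> ff' gg' i le_in; rewrite !fps_mulE; apply: eq_bigr => j _.
rewrite ff' ?gg' //; first by rewrite (leq_trans (leq_subr _ _)).
by have := ltn_ord j; lia.
Qed.

Lemma fps_exp_eq f g n : (forall i, (i <= n)%N -> f i = g i) ->
  forall k i, (i <= n)%N -> (f ^+ k) i = (g ^+ k) i.
Proof. by move=> fg; elim=> [|k IHk] //; rewrite !exprS; apply: fps_mul_eq. Qed.

(** * Formal derivative and exponential *)

Definition fps_deriv f : fps K := fun n => f n.+1 *+ n.+1.

Lemma fps_derivM f g : fps_deriv (f * g) = fps_deriv f * g + f * fps_deriv g.
Proof.
apply/funext => n; pose F := fps_trunc n.+1 f; pose G := fps_trunc n.+1 g.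
have -> : fps_deriv (f * g) n = ((F * G)^`())`_n.
  by rewrite coef_deriv /fps_deriv; congr (_ *+ _); apply: fps_mul_trunc.
rewrite derivM coefD fps_addE !coefM; congr (_ + _); apply: eq_bigr => i _.
  by rewrite coef_deriv !coef_fps_trunc //; have := ltn_ord i; lia.
by rewrite coef_deriv !coef_fps_trunc //; have := ltn_ord i; lia.
Qed.

Lemma fps_derivD f g : fps_deriv (f + g) = fps_deriv f + fps_deriv g.
Proof. by apply/funext => n; rewrite /fps_deriv !fps_addE mulrnDl. Qed.

Lemma fps_derivX f k :
  fps_deriv (f ^+ k.+1) = fps_deriv f * f ^+ k *+ k.+1.
Proof.
elim: k => [|k IHk]; first by rewrite expr1 expr0 mulr1.
rewrite exprS fps_derivM IHk (mulrS _ k.+1); congr (_ + _).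
by rewrite mulrnAr exprS mulrCA.
Qed.

Hypothesis charK : forall n, (n.+1%:R : K) != 0.

(** The equation f' = u f expresses (n+1) f_(n+1) through lower coefficients, and n+1 is invertible.
    Identities between exponentials are proved through this uniqueness. *)
Lemma fps_ode_unique u f g : fps_deriv f = u * f -> fps_deriv g = u * g ->
  f 0%N = g 0%N -> f = g.
Proof.
move=> Df Dg fg0; apply/funext => n.
elim/ltn_ind: n => -[|n] IHn //.
have: fps_deriv f n = fps_deriv g n.
  rewrite Df Dg !fps_mulE; apply: eq_bigr => i _; rewrite IHn //.
  exact: leq_subr.
rewrite /fps_deriv -(mulr_natr (f _)) -(mulr_natr (g _)); exact: mulIf.
Qed.

(** Powers f^k with k > n have no term of degree n, so the range of summation may be lengthened; a
    range common to several degrees allows sums to be exchanged. *)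
Lemma fps_expoE f N n : f 0%N = 0 -> (n < N)%N ->
  fps_expo f n = \sum_(k < N) (f ^+ k) n / k`!%:R.
Proof.
move=> f0 ltnN; rewrite /fps_expo.
rewrite (big_ord_widen_cond _ xpredT (fun k => fps_exp f k n / k`!%:R) ltnN).
rewrite big_mkcond; apply: eq_bigr => k _; rewrite ltnS fps_expE.
by case: leqP => // lt_nk; rewrite fps_exp_order ?mul0r.
Qed.

Lemma fps_expo_coef0 f : fps_expo f 0%N = 1.
Proof. by rewrite /fps_expo big_ord1 fact0 divr1. Qed.

(** Termwise, the derivative of f^(k+1)/(k+1)! is f' f^k/k!. *)
Lemma fps_expo_deriv f : f 0%N = 0 ->
  fps_deriv (fps_expo f) = fps_deriv f * fps_expo f.
Proof.
move=> f0; apply/funext => n; rewrite fps_mulE /fps_deriv.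
rewrite (@fps_expoE _ n.+2) // big_ord_recl /= expr0 fps_oneE mul0r add0r.
under [RHS]eq_bigr => i _ do
  rewrite (@fps_expoE _ n.+1) ?ltnS ?leq_subr // mulr_sumr.
rewrite exchange_big /= -sumrMnl; apply: eq_bigr => k _.
transitivity (fps_deriv (f ^+ k.+1) n / k.+1`!%:R).
  by rewrite -mulrnAl.
rewrite fps_derivX fps_mulrnE fps_mulE -(mulr_natr (\sum_(_ < _) _)).
rewrite factS natrM invfM !mulrA mulfK ?charK //.
by rewrite mulr_suml; apply: eq_bigr => i _; rewrite mulrA.
Qed.

(** Both sides solve y' = (f + g)' y with constant term 1. *)
Lemma fps_expoD f g : f 0%N = 0 -> g 0%N = 0 ->
  fps_expo (f + g) = fps_expo f * fps_expo g.
Proof.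
move=> f0 g0; apply: (@fps_ode_unique (fps_deriv (f + g))).
- by rewrite fps_expo_deriv // fps_addE f0 g0 addr0.
- rewrite fps_derivM !fps_expo_deriv // fps_derivD mulrDl -mulrA.
  by rewrite [X in _ + X]mulrCA.
- by rewrite fps_coef0M !fps_expo_coef0 mulr1.
Qed.

Lemma fps_expo0 : fps_expo (0 : fps K) = 1.
Proof.
apply: (@fps_ode_unique 0); rewrite ?fps_expo_coef0 // ?fps_expo_deriv //.
  by congr (_ * _); apply/funext => n; rewrite /fps_deriv mul0rn.
by rewrite mul0r; apply/funext => n; rewrite /fps_deriv fps_oneE mul0rn.
Qed.

Lemma fps_expo_sum n (F : 'I_n -> fps K) : (forall j, F j 0%N = 0) ->
  fps_expo (\sum_j F j) = \prod_j fps_expo (F j).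
Proof.
move=> F0.
have: fps_expo (\sum_j F j) = \prod_j fps_expo (F j) /\
      (\sum_j F j) 0%N = 0.
  elim/big_rec2: _ => [|j f g _ [<- g0]]; first by rewrite fps_expo0.
  by rewrite fps_expoD // fps_addE F0 g0 addr0.
by case.
Qed.

Lemma fps_expoX f k : f 0%N = 0 -> fps_expo f ^+ k = fps_expo (f *+ k).
Proof.
move=> f0; elim: k => [|k IHk]; first by rewrite mulr0n fps_expo0.
by rewrite exprS IHk mulrS fps_expoD // fps_mulrnE f0 mul0rn.
Qed.

Lemma fps_expo_eq f g n : (forall i, (i <= n)%N -> f i = g i) ->
  fps_expo f n = fps_expo g n.
Proof.
move=> fg; rewrite /fps_expo; apply: eq_bigr => k _.
by rewrite !fps_expE (fps_exp_eq fg).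
Qed.

(** * Substitution of a T^d for T *)

Lemma fps_comp_monomial1 a d : (0 < d)%N ->
  fps_comp_monomial (1 : fps K) a d = 1.
Proof.
move=> d_gt0; apply/funext => n; rewrite /fps_comp_monomial !fps_oneE.
case: n => [|n]; first by rewrite dvdn0 div0n mulr1.
case: ifP => // d_dv; rewrite -(eqn_pmul2r d_gt0) divnK //.
by rewrite mul0r.
Qed.

Lemma fps_comp_monomialM f g a d : (0 < d)%N ->
  fps_comp_monomial (f * g) a d =
  fps_comp_monomial f a d * fps_comp_monomial g a d.
Proof.
move=> d_gt0; apply/funext => n; rewrite fps_mulE.
(* If [d] does not divide [n], it cannot divide both [i] and [n - i]. Otherwise only multiples [i]
   of [d] survive in the convolution, and they are reindexed. *)
case d_dv: (d %| n)%N; last first.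
  rewrite {1}/fps_comp_monomial d_dv big1 // => i _; rewrite /fps_comp_monomial.
  case: ifP => d_i; rewrite ?mul0r //; case: ifP => d_ni; rewrite ?mulr0 //.
  by rewrite -(subnKC (ltn_ord i : (i <= n)%N)) dvdn_add in d_dv.
case/dvdnP: d_dv => q ->.
rewrite {1}/fps_comp_monomial dvdn_mull // mulnK // fps_mulE mulr_suml.
rewrite -(big_mkord predT (fun i =>
  fps_comp_monomial f a d i * fps_comp_monomial g a d (q * d - i)%N)).
rewrite (bigID (fun i => d %| i)%N) /= [X in _ + X]big1 ?addr0; last first.
  by move=> i; rewrite /fps_comp_monomial => /negPf->; rewrite mul0r.
rewrite -(big_mkord predT (fun i => f i * g (q - i)%N * a ^+ q)).
rewrite -[RHS]big_filter.
have -> : [seq i <- index_iota 0 (q * d).+1 | (d %| i)%N] =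
          [seq (i * d)%N | i <- index_iota 0 q.+1].
  apply: (irr_sorted_eq ltn_trans ltnn).
  - by apply: sorted_filter; [exact: ltn_trans|exact: iota_ltn_sorted].
  - rewrite sorted_map; apply: sub_sorted (iota_ltn_sorted 0 q.+1) => i j /=.
    by rewrite ltn_pmul2r.
  move=> i; rewrite mem_filter mem_index_iota leq0n andTb.
  apply/andP/mapP => [[/dvdnP [j ->]]|[j]].
    rewrite ltnS leq_pmul2r // => le_jq; exists j => //.
    by rewrite mem_index_iota.
  rewrite mem_index_iota /= => le_jq ->.
  by rewrite dvdn_mull // ltnS leq_pmul2r.
rewrite big_map [LHS]big_nat [RHS]big_nat; apply: eq_bigr => i /andP [_ le_iq].
rewrite /fps_comp_monomial -mulnBl !dvdn_mull // !mulnK //.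
by rewrite mulrACA -exprD subnKC.
Qed.

Lemma fps_comp_monomialX f a d k : (0 < d)%N ->
  fps_comp_monomial (f ^+ k) a d = fps_comp_monomial f a d ^+ k.
Proof.
move=> d_gt0; elim: k => [|k IHk]; first by rewrite fps_comp_monomial1.
by rewrite !exprS fps_comp_monomialM // IHk.
Qed.

(** Substitution is multiplicative, hence commutes with each f^k/k!. The two exponential sums have
    different ranges, which [fps_expoE] reconciles. *)
Lemma fps_expo_comp_monomial f a d : (0 < d)%N -> f 0%N = 0 ->
  fps_comp_monomial (fps_expo f) a d = fps_expo (fps_comp_monomial f a d).
Proof.
move=> d_gt0 f0; apply/funext => n; rewrite /fps_comp_monomial; case: ifP => d_n.
  rewrite (@fps_expoE _ n.+1 (n %/ d)) //; last by rewrite ltnS leq_div.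
  rewrite mulr_suml; apply: eq_bigr => k _; rewrite fps_expE -fps_comp_monomialX //.
  by rewrite /fps_comp_monomial d_n mulrAC.
rewrite /fps_expo big1 // => k _; rewrite fps_expE -fps_comp_monomialX //.
by rewrite /fps_comp_monomial d_n mul0r.
Qed.

Lemma fps_expo_monomial c n : 
  fps_expo (fun i => if i == 1%N then c else 0 : K) n = c ^+ n / n`!%:R.
Proof.
set f : fps K := fun n => _.
have fX k i : (f ^+ k) i = (i == k)%N%:R * c ^+ k.
  elim: k i => [|k IHk] i; first by rewrite mulr1.
  rewrite exprS fps_mulE; case: i => [|i].
    by rewrite big_ord1 /f /= !mul0r.
  rewrite !big_ord_recl /= {1}/f mul0r add0r {1}/f /= big1 ?addr0 => [|j _].
    by rewrite IHk subn1 /= eqSS exprS mulrCA.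
  by rewrite /f /= mul0r.
rewrite /fps_expo big_ord_recr /= fps_expE fX eqxx mul1r big1 ?add0r // => i _.
by rewrite fps_expE fX gtn_eqF ?mul0r.
Qed.

End FpsRing.

(** * Congruences in a subring, and Witt vectors with given phantom components *)

Section Subring.
Variables (S : comNzRingType) (A : set S).

(** Subrings are predicates, so that Q_p, Z_p, Z_p[a], Z_p[X], the unit ball, finite-dimensional
    subalgebras and power series over these are treated uniformly. *)
Record is_subring : Prop := {
  subring1 : A 1;
  subringB : forall x y, A x -> A y -> A (x - y);
  subringM : forall x y, A x -> A y -> A (x * y)
}.

Hypothesis subA : is_subring.

Lemma subring0 : A 0.
Proof. by rewrite -(subrr 1); apply: (subringB subA); apply: subring1. Qed.

Lemma subringN x : A x -> A (- x).
Proof. by move=> Ax; rewrite -sub0r; apply: (subringB subA) => //; apply: subring0. Qed.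

Lemma subringD x y : A x -> A y -> A (x + y).
Proof.
by move=> Ax Ay; rewrite -[y]opprK; apply: (subringB subA) => //; apply: subringN.
Qed.

Lemma subring_sum (I : Type) (r : seq I) (Q : pred I) (F : I -> S) :
  (forall i, Q i -> A (F i)) -> A (\sum_(i <- r | Q i) F i).
Proof. by move=> AF; elim/big_ind: _ => //; [exact: subring0|exact: subringD]. Qed.

Lemma subring_prod (I : Type) (r : seq I) (Q : pred I) (F : I -> S) :
  (forall i, Q i -> A (F i)) -> A (\prod_(i <- r | Q i) F i).
Proof.
by move=> AF; elim/big_ind: _ => //; [exact: subring1|exact: (subringM subA)].
Qed.

Lemma subringX x n : A x -> A (x ^+ n).
Proof.
move=> Ax; elim: n => [|n IHn]; first exact: subring1.
by rewrite exprS; apply: (subringM subA).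
Qed.

Lemma subring_nat n : A n%:R.
Proof.
elim: n => [|n IHn]; first exact: subring0.
by rewrite -natr1; apply: subringD => //; apply: subring1.
Qed.

Lemma subring_mulrn x n : A x -> A (x *+ n).
Proof.
by move=> Ax; rewrite -mulr_natr; apply: (subringM subA) => //; apply: subring_nat.
Qed.

Variables (p : nat) (p_prime : prime p).

(** The quotient has to lie in [A]: in the ambient rings used below, K and K[X], [p] is
    invertible. *)
Definition cong (C : nat) (x y : S) : Prop :=
  exists2 z, A z & x - y = p%:R ^+ C * z.

Lemma cong_refl C x : cong C x x.
Proof. by exists 0; [exact: subring0|rewrite subrr mulr0]. Qed.

Lemma cong_sym C x y : cong C x y -> cong C y x.
Proof.
by case=> z Az e; exists (- z); [exact: subringN|rewrite -opprB e mulrN].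
Qed.

Lemma cong_trans C y x z : cong C x y -> cong C y z -> cong C x z.
Proof.
case=> u Au eu [v Av ev]; exists (u + v); first exact: subringD.
by rewrite mulrDr -eu -ev addrA subrK.
Qed.

Lemma congD C x y x' y' : cong C x y -> cong C x' y' -> cong C (x + x') (y + y').
Proof.
case=> u Au eu [v Av ev]; exists (u + v); first exact: subringD.
by rewrite mulrDr -eu -ev opprD addrACA.
Qed.

Lemma congN C x y : cong C x y -> cong C (- x) (- y).
Proof.
case=> u Au eu; exists (- u); first exact: subringN.
by rewrite mulrN -eu opprB opprK addrC.
Qed.

Lemma congB C x y x' y' : cong C x y -> cong C x' y' -> cong C (x - x') (y - y').
Proof. by move=> xy xy'; apply: congD => //; apply: congN. Qed.

Lemma cong_sum C n (F G : 'I_n -> S) : (forall i, cong C (F i) (G i)) ->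
  cong C (\sum_i F i) (\sum_i G i).
Proof.
by move=> FG; elim/big_ind2: _ => //; [exact: cong_refl|move=> *; exact: congD].
Qed.

Lemma congMl C x y z : A z -> cong C x y -> cong C (z * x) (z * y).
Proof.
move=> Az [u Au eu]; exists (z * u); first exact: (subringM subA).
by rewrite -mulrBr eu mulrCA.
Qed.

Lemma congM C x y x' y' : A x -> A y' -> cong C x y -> cong C x' y' ->
  cong C (x * x') (y * y').
Proof.
move=> Ax Ay' xy xy'; apply: (@cong_trans _ (x * y')); first exact: congMl.
by rewrite ![_ * y']mulrC; apply: congMl.
Qed.

Lemma congX C n x y : A x -> A y -> cong C x y -> cong C (x ^+ n) (y ^+ n).
Proof.
move=> Ax Ay xy; elim: n => [|n IHn]; first exact: cong_refl.
by rewrite !exprS; apply: congM => //; apply: subringX.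
Qed.

Lemma cong_subring C x y : A y -> cong C x y -> A x.
Proof.
move=> Ay [z Az e]; rewrite -[x](subrK y) e; apply: subringD => //.
by apply: (subringM subA) => //; apply: subringX; apply: subring_nat.
Qed.

Lemma cong_leq C D x y : (D <= C)%N -> cong C x y -> cong D x y.
Proof.
move=> leDC [z Az e]; exists (p%:R ^+ (C - D) * z).
  by apply: (subringM subA) => //; apply: subringX; apply: subring_nat.
by rewrite mulrA -exprD subnKC.
Qed.

(** In x^p - y^p = (x - y) (x^(p-1) + ... + y^(p-1)) the second factor is congruent to p y^(p-1),
    hence to 0, modulo p, and so supplies the extra power of p. *)
Lemma cong_expp C x y : A x -> A y ->
  cong C.+1 x y -> cong C.+2 (x ^+ p) (y ^+ p).
Proof.
move=> Ax Ay xy; have [z Az exy] := xy.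
have [w Aw ew] : cong 1 (\sum_(i < p) x ^+ (p.-1 - i) * y ^+ i) 0.
  apply: (@cong_trans _ (\sum_(i < p) y ^+ p.-1)).
    apply: cong_sum => i.
    have -> : y ^+ p.-1 = y ^+ (p.-1 - i) * y ^+ i.
      by rewrite -exprD subnK //; have := ltn_ord i; lia.
    apply: congM; [exact: subringX|exact: subringX| |exact: cong_refl].
    by apply: congX => //; apply: cong_leq xy.
  exists (y ^+ p.-1); first exact: subringX.
  by rewrite subr0 sumr_const card_ord expr1 mulr_natl.
exists (z * w); first exact: (subringM subA).
by rewrite subrXX exy -[X in _ * X]subr0 ew (exprSr _ C.+1) expr1; ring.
Qed.

Lemma cong_exppX C k x y : A x -> A y ->
  cong C.+1 x y -> cong (C + k).+1 (x ^+ (p ^ k)) (y ^+ (p ^ k)).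
Proof.
move=> Ax Ay xy; elim: k => [|k IHk]; first by rewrite addn0 expn0 !expr1.
by rewrite addnS expnSr !exprM; apply: cong_expp => //; apply: subringX.
Qed.

Lemma cong_freshman x y : A x -> A y -> cong 1 ((x + y) ^+ p) (x ^+ p + y ^+ p).
Proof.
move=> Ax Ay; have p_gt0 := prime_gt0 p_prime; pose q := p.-1.
have ep : p = q.+1 by rewrite prednK.
(* The middle terms of the binomial expansion, with each coefficient divided by [p]. *)
exists (\sum_(i < q) (x ^+ (p - i.+1) * y ^+ i.+1) *+ ('C(p, i.+1) %/ p)).
  apply: subring_sum => i _; apply: subring_mulrn.
  by apply: (subringM subA); apply: subringX.
have -> : (x + y) ^+ p = x ^+ p + y ^+ p +
    \sum_(i < q) (x ^+ (p - i.+1) * y ^+ i.+1) *+ 'C(p, i.+1).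
  rewrite exprDn ep big_ord_recl big_ord_recr /= subn0 expr0 mulr1 bin0 mulr1n.
  rewrite /bump /= add1n subnn expr0 mul1r binn mulr1n addrA addrAC.
  by congr (_ + _ + _); apply: eq_bigr => i _; rewrite add1n.
rewrite addrC addKr expr1 mulr_sumr; apply: eq_bigr => i _.
rewrite mulr_natl -mulrnA divnK //.
apply: prime_dvd_bin => //; have := ltn_ord i; rewrite /q; lia.
Qed.

Lemma congMpX C i x y : cong C x y -> cong (i + C) (p%:R ^+ i * x) (p%:R ^+ i * y).
Proof. by case=> z Az e; exists z => //; rewrite -mulrBr e exprD mulrA. Qed.

Lemma cong_divpX C i (u x y : S) : u * p%:R ^+ i = 1 ->
  cong (i + C) (p%:R ^+ i * x) (p%:R ^+ i * y) -> cong C x y.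
Proof.
move=> ui [z Az e]; exists z => //.
by rewrite -[x - y]mul1r -ui -mulrA mulrBr e exprD !mulrA ui mul1r.
Qed.

(** If component i is known modulo p^(C-i), then its summand p^i lambda_i^(p^(n-i)) is known modulo
    p^C. Component n is isolated by subtracting the earlier summands and dividing by p^n, which
    costs n powers of p. *)
Lemma witt_cong (lambda mu : nat -> S) C (u : S) : u * p%:R = 1 ->
    (forall n, A (mu n)) ->
    (forall n, (n <= C)%N -> cong C
       (\sum_(i < n.+1) p%:R ^+ i * lambda i ^+ (p ^ (n - i)))
       (\sum_(i < n.+1) p%:R ^+ i * mu i ^+ (p ^ (n - i)))) ->
  forall n, (n <= C)%N -> cong (C - n) (lambda n) (mu n).
Proof.
move=> up Amu gh; elim/ltn_ind => n IHn leC.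
apply: (cong_divpX (u := u ^+ n) (i := n)); first by rewrite -exprMn up expr1n.
rewrite subnKC //; move: (gh n leC); rewrite !big_ord_recr /= subnn !expr1.
set a := \sum_(_ < _) _; set b := \sum_(_ < _) _ => h.
have ab : cong C a b.
  apply: cong_sum => i; have lt_in := ltn_ord i.
  have le_iC : (i <= C)%N by rewrite (leq_trans (ltnW lt_in)).
  rewrite -(subnKC le_iC); apply: congMpX; have h1 := IHn i lt_in le_iC.
  by apply: congX => //; exact: cong_subring h1.
by have := congB h ab; rewrite ![_ + _ - _]addrAC !subrr !add0r.
Qed.

End Subring.

Section WittOfGhost.
Variables (S : comNzRingType) (p : nat) (u : S) (phi : nat -> S).
Hypothesis up : u * p%:R = 1.

(** Solving the phantom equations is a course-of-values recursion, so the list of all earlier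
    components is carried along; [u] is the inverse of [p]. *)
Fixpoint witt_prefix (n : nat) : seq S :=
  if n is n'.+1 then let s := witt_prefix n' in
    rcons s (u ^+ n' *
      (phi n' - \sum_(i < n') p%:R ^+ i * s`_i ^+ (p ^ (n' - i))))
  else [::].

Definition witt_of_ghost (n : nat) : S := (witt_prefix n.+1)`_n.

Lemma size_witt_prefix n : size (witt_prefix n) = n.
Proof. by elim: n => //= n IHn; rewrite size_rcons IHn. Qed.

Lemma nth_witt_prefix n i : (i < n)%N -> (witt_prefix n)`_i = witt_of_ghost i.
Proof.
elim: n => // n IHn; rewrite ltnS leq_eqVlt => /predU1P [->//|lt_in].
by rewrite /= nth_rcons size_witt_prefix lt_in IHn.
Qed.

Lemma witt_of_ghostP n :
  \sum_(i < n.+1) p%:R ^+ i * witt_of_ghost i ^+ (p ^ (n - i)) = phi n.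
Proof.
have prefixE : \sum_(i < n) p%:R ^+ i * witt_of_ghost i ^+ (p ^ (n - i)) =
    \sum_(i < n) p%:R ^+ i * (witt_prefix n)`_i ^+ (p ^ (n - i)).
  by apply: eq_bigr => i _; rewrite nth_witt_prefix.
rewrite big_ord_recr /= subnn expr1 prefixE /witt_of_ghost /=.
rewrite nth_rcons size_witt_prefix ltnn eqxx mulrA -exprMn (mulrC p%:R) up.
by rewrite expr1n mul1r addrC subrK.
Qed.

End WittOfGhost.

(** * The p-adic absolute value, Q_p and Z_p *)

Section QpAlg.
Variables (p : nat) (p_prime : prime p) (R : realType) (K : closedFieldType).
Variables (abs : K -> R) (K_Qp_alg : Qp_alg abs p).
Local Notation Qp := (Qp abs).
Local Notation Zp := (Defs.Zp abs).

Let absM := Qp_alg_absM K_Qp_alg.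
Let absD := Qp_alg_absD K_Qp_alg.

Lemma abs0 : abs 0 = 0. Proof. exact/(Qp_alg_abs_eq0 K_Qp_alg). Qed.

(** As K is algebraically closed, x is a square, so |x| is the square of a real number. *)
Lemma abs_ge0 x : 0 <= abs x.
Proof.
have [y] := @solve_monicpoly K 2 (fun i => if i == 0%N then x else 0) isT.
rewrite big_ord_recl big_ord1 /= mul0r addr0 expr0 mulr1 expr2 => <-.
by rewrite absM sqr_ge0.
Qed.

Lemma abs_eq0 x : (abs x == 0) = (x == 0).
Proof. by apply/eqP/eqP => /(Qp_alg_abs_eq0 K_Qp_alg). Qed.

Lemma abs_gt0 x : (0 < abs x) = (x != 0).
Proof. by rewrite lt_def abs_ge0 andbT abs_eq0. Qed.

Lemma abs1 : abs 1 = 1.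
Proof.
have: abs 1 != 0 by rewrite abs_eq0 oner_eq0.
by move=> /mulfI; apply; rewrite -absM !mulr1.
Qed.

Lemma absX x n : abs (x ^+ n) = abs x ^+ n.
Proof. by elim: n => [|n IHn]; rewrite ?expr0 ?abs1 // !exprS absM IHn. Qed.

Lemma absN x : abs (- x) = abs x.
Proof.
have absN1 : abs (-1) = 1.
  by apply/eqP; rewrite -(@pexpr_eq1 _ _ 2) ?abs_ge0 // -absX sqrrN expr1n abs1.
by rewrite -mulN1r absM absN1 mul1r.
Qed.

Lemma absBC x y : abs (x - y) = abs (y - x).
Proof. by rewrite -opprB absN. Qed.

Lemma absV x : abs x^-1 = (abs x)^-1.
Proof.
have [->|x0] := eqVneq x 0; first by rewrite invr0 abs0 invr0.
apply: (mulfI (x := abs x)); rewrite ?abs_eq0 // -absM.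
by rewrite !divff ?abs_eq0 // abs1.
Qed.

Lemma absD_le x y r : abs x <= r -> abs y <= r -> abs (x + y) <= r.
Proof. by move=> xr yr; rewrite (le_trans (absD _ _)) // ge_max xr. Qed.

Lemma absD_lt x y r : abs x < r -> abs y < r -> abs (x + y) < r.
Proof. by move=> xr yr; rewrite (le_lt_trans (absD _ _)) // gt_max xr. Qed.

Lemma absB_le x y r : abs x <= r -> abs y <= r -> abs (x - y) <= r.
Proof. by move=> xr yr; apply: absD_le; rewrite ?absN. Qed.

Lemma absB_lt x y r : abs x < r -> abs y < r -> abs (x - y) < r.
Proof. by move=> xr yr; apply: absD_lt; rewrite ?absN. Qed.

Lemma abs_sum_le (I : Type) (r : seq I) (Q : pred I) (F : I -> K) c : 0 <= c ->
  (forall i, Q i -> abs (F i) <= c) -> abs (\sum_(i <- r | Q i) F i) <= c.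
Proof.
by move=> c0 Fc; elim/big_ind: _ => [|x y|]; [rewrite abs0|exact: absD_le|].
Qed.

Lemma abs_sum_lt (I : Type) (r : seq I) (Q : pred I) (F : I -> K) c : 0 < c ->
  (forall i, Q i -> abs (F i) < c) -> abs (\sum_(i <- r | Q i) F i) < c.
Proof.
by move=> c0 Fc; elim/big_ind: _ => [|x y|]; [rewrite abs0|exact: absD_lt|].
Qed.

(** The isosceles triangle principle: |x| < |y| together with |x - y| < |y| would give |y| < |y|. *)
Lemma abs_eq_of_lt x y : abs (x - y) < abs y -> abs x = abs y.
Proof.
move=> xy; apply/eqP; rewrite eq_le; apply/andP; split.
  by rewrite -[x](subrK y); apply: absD_le; [exact: ltW|].
rewrite leNgt; apply/negP => lt_xy; have := absB_lt xy lt_xy.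
by rewrite addrAC subrr sub0r absN ltxx.
Qed.

Lemma abs_p : abs p%:R = p%:R^-1.
Proof.
rewrite (Qp_alg_abs_nat K_Qp_alg) ?prime_gt0 //.
by rewrite (logn_prime p p_prime) eqxx expr1.
Qed.

Lemma pR_gt1 : 1 < p%:R :> R.
Proof. by rewrite ltr1n prime_gt1. Qed.

Lemma pR_gt0 : 0 < p%:R :> R.
Proof. by rewrite ltr0n prime_gt0. Qed.

Lemma abs_p_gt0 : 0 < abs p%:R.
Proof. by rewrite abs_p invr_gt0 pR_gt0. Qed.

Lemma abs_p_lt1 : abs p%:R < 1.
Proof. by rewrite abs_p invf_lt1 ?pR_gt1 ?pR_gt0. Qed.

Lemma natK_neq0 n : (n.+1%:R : K) != 0.
Proof.
by rewrite -abs_gt0 (Qp_alg_abs_nat K_Qp_alg) // invr_gt0 exprn_gt0 ?pR_gt0.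
Qed.

Lemma pK_neq0 : (p%:R : K) != 0.
Proof. by rewrite -(prednK (prime_gt0 p_prime)) natK_neq0. Qed.

Lemma pXK_neq0 n : (p%:R ^+ n : K) != 0.
Proof. by rewrite expf_neq0 ?pK_neq0. Qed.

Lemma abs_nat_le1 n : abs n%:R <= 1.
Proof.
case: n => [|n]; first by rewrite abs0.
rewrite (Qp_alg_abs_nat K_Qp_alg) // invf_le1 ?exprn_gt0 ?pR_gt0 //.
by rewrite exprn_ege1 // ltW ?pR_gt1.
Qed.

Lemma abs_dvdn n : (p %| n)%N -> abs n%:R <= abs p%:R.
Proof.
move=> /dvdnP [q ->]; rewrite natrM absM ler_piMl ?abs_nat_le1 //.
by rewrite ltW ?abs_p_gt0.
Qed.

Lemma abs_int_dvd (z : int) : (p %| z)%Z -> abs z%:~R <= abs p%:R.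
Proof.
rewrite dvdzE => /abs_dvdn.
by rewrite pmulrn; case: (intP z) => // n; rewrite ?abszN // mulrNz absN.
Qed.

Lemma abs_int_eq1 (z : int) : ~~ (p %| z)%Z -> abs z%:~R = 1.
Proof.
have nat_eq1 n : ~~ (p %| n)%N -> abs n%:R = 1.
  move=> p_n; have n_gt0 : (0 < n)%N by case: n p_n; rewrite ?dvdn0.
  rewrite (Qp_alg_abs_nat K_Qp_alg) // (_ : logn p n = 0%N) ?expr0 ?invr1 //.
  by apply/eqP; rewrite -leqn0 leqNgt -(pfactor_dvdn 1).
rewrite dvdzE /=; case: z => n; first exact: nat_eq1.
by rewrite NegzE abszN mulrNz absN => /nat_eq1.
Qed.

Lemma expr_small (r e : R) : 0 <= r -> r < 1 -> 0 < e ->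
  exists N, forall n, (N <= n)%N -> r ^+ n < e.
Proof.
move=> r0 r1 e0; have: ((fun n => r ^+ n) @ \oo --> (0 : R))%classic.
  by apply: cvg_expr; rewrite ger0_norm.
move/cvgrPdist_lt => /(_ e e0) [N _ HN]; exists N => n /HN /=.
by rewrite sub0r normrN ger0_norm // exprn_ge0.
Qed.

Lemma abs_cvgP (u : nat -> K) l : abs_cvg abs u l <->
  forall e, 0 < e -> exists N, forall n, (N <= n)%N -> abs (u n - l) < e.
Proof.
split=> [/cvgrPdist_lt cu e e0|cu].
  have [N _ HN] := cu e e0; exists N => n /HN /=.
  by rewrite sub0r normrN ger0_norm // abs_ge0.
apply/cvgrPdist_lt => e e0; have [N HN] := cu e e0; exists N => // n /= /HN.
by rewrite sub0r normrN ger0_norm // abs_ge0.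
Qed.

Lemma abs_cvg_unique u l l' : abs_cvg abs u l -> abs_cvg abs u l' -> l = l'.
Proof.
move=> /abs_cvgP ul /abs_cvgP ul'; apply/eqP; rewrite -subr_eq0 -abs_eq0.
apply/negP => /negP; rewrite abs_eq0 -abs_gt0 => ll'.
have [N HN] := ul _ ll'; have [N' HN'] := ul' _ ll'.
have := absB_lt (HN' _ (leq_maxr N N')) (HN _ (leq_maxl N N')).
by rewrite opprB addrC subrKA ltxx.
Qed.

(** Turns closure properties of Q_p into epsilon estimates on single rational approximations. *)
Lemma QpP x : Qp x <-> forall e, 0 < e -> exists q : rat, abs (x - ratr q) < e.
Proof.
split=> [[q /abs_cvgP qx] e e0|app].
  by have [N HN] := qx e e0; exists (q N); rewrite absBC HN.
have inv_gt0 n : 0 < n.+1%:R^-1 :> R by rewrite invr_gt0.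
pose q n := projT1 (cid (app _ (inv_gt0 n))).
exists q; apply/abs_cvgP => e e0.
have [N _ HN] := near_infty_natSinv_lt (PosNum e0).
exists N => n /HN /=; apply: lt_trans; rewrite absBC /q.
by case: (cid _).
Qed.

Lemma Qp_ratr q : Qp (ratr q).
Proof. by apply/QpP => e e0; exists q; rewrite subrr abs0. Qed.

Lemma Qp_nat n : Qp n%:R.
Proof. by rewrite -(ratr_nat K n); apply: Qp_ratr. Qed.


Lemma intK_neq0 (z : int) : z != 0 -> (z%:~R : K) != 0.
Proof.
case: z => [[|n]|n] // _; first exact: natK_neq0.
by rewrite NegzE mulrNz oppr_eq0 natK_neq0.
Qed.

(** Compatibility of [ratr] with the field operations is derived from fractions of integers;
    characteristic 0 keeps the denominators invertible in K. *)
Lemma ratr_frac (a b : int) : b != 0 ->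
  ratr (a%:~R / b%:~R : rat) = a%:~R / b%:~R :> K.
Proof.
move=> b0; set q := _ / _ : rat.
have bQ0 : (b%:~R : rat) != 0 by rewrite intr_eq0.
have dQ0 : ((denq q)%:~R : rat) != 0 by rewrite intr_eq0 denq_neq0.
have: numq q * b = a * denq q.
  apply: (@intr_inj rat); rewrite !intrM; apply/eqP.
  by rewrite -eqr_div //= divq_num_den.
move=> /(congr1 (fun z : int => z%:~R : K)); rewrite !intrM => e.
by apply/eqP; rewrite /ratr eqr_div ?intK_neq0 ?denq_neq0 // e mulrC.
Qed.


Lemma ratr_num_den (q : rat) : ratr q = (numq q)%:~R / (denq q)%:~R :> K.
Proof. by []. Qed.

Lemma ratr_sub q r : ratr (q - r) = ratr q - ratr r :> K.
Proof.
have [dq dr] := (denq_neq0 q, denq_neq0 r).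
have -> : q - r =
    (numq q * denq r - numq r * denq q)%:~R / (denq q * denq r)%:~R.
  have -> : q - r = (numq q)%:~R / (denq q)%:~R - (numq r)%:~R / (denq r)%:~R.
    by rewrite !divq_num_den.
  by rewrite rmorphB !rmorphM /=; field; rewrite !intr_eq0 dr.
rewrite ratr_frac ?mulf_neq0 // rmorphB !rmorphM /= !ratr_num_den.
by field; rewrite !intK_neq0.
Qed.

Lemma ratr_mul q r : ratr (q * r) = ratr q * ratr r :> K.
Proof.
have [dq dr] := (denq_neq0 q, denq_neq0 r).
have -> : q * r = (numq q * numq r)%:~R / (denq q * denq r)%:~R.
  have -> : q * r = (numq q)%:~R / (denq q)%:~R * ((numq r)%:~R / (denq r)%:~R).
    by rewrite !divq_num_den.
  by rewrite !rmorphM /=; field; rewrite !intr_eq0 dr.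
by rewrite ratr_frac ?mulf_neq0 // !rmorphM /= !ratr_num_den mulf_div.
Qed.

Lemma ratr_inv q : ratr q^-1 = (ratr q)^-1 :> K.
Proof.
have [->|q0] := eqVneq q 0; first by rewrite invr0 (ratr_nat K 0) invr0.
have -> : q^-1 = (denq q)%:~R / (numq q)%:~R.
  by rewrite -[RHS]invf_div divq_num_den.
by rewrite ratr_frac ?numq_eq0 // ratr_num_den invf_div.
Qed.

Lemma QpB x y : Qp x -> Qp y -> Qp (x - y).
Proof.
move=> /QpP xQ /QpP yQ; apply/QpP => e e0.
have [q xq] := xQ e e0; have [r yr] := yQ e e0; exists (q - r).
rewrite ratr_sub (_ : _ - _ = (x - ratr q) - (y - ratr r)); last by ring.
exact: absB_lt.
Qed.

Lemma QpM x y : Qp x -> Qp y -> Qp (x * y).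
Proof.
move=> /QpP xQ /QpP yQ; apply/QpP => e e0.
have x1_gt0 : 0 < abs x + 1 by rewrite ltr_wpDl ?abs_ge0.
(* [r] is chosen before [q], since the precision required of [q] depends on |r|; the added 1 keeps
   the divisors positive. *)
have [r yr] := yQ _ (divr_gt0 e0 x1_gt0).
have r1_gt0 : 0 < abs (ratr r) + 1 by rewrite ltr_wpDl ?abs_ge0.
have [q xq] := xQ _ (divr_gt0 e0 r1_gt0); exists (q * r).
rewrite ratr_mul.
rewrite (_ : _ - _ = x * (y - ratr r) + (x - ratr q) * ratr r); last by ring.
rewrite ltr_pdivlMr // in xq; rewrite ltr_pdivlMr // in yr.
apply: absD_lt; rewrite absM.
  apply: le_lt_trans yr; rewrite mulrC ler_wpM2l ?abs_ge0 //; lra.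
apply: le_lt_trans xq; rewrite ler_wpM2l ?abs_ge0 //; lra.
Qed.

Lemma QpV x : Qp x -> Qp x^-1.
Proof.
have [->|x0] := eqVneq x 0; first by rewrite invr0.
move=> /QpP xQ; apply/QpP => e e0; have ax0 : 0 < abs x by rewrite abs_gt0.
(* The first bound forces |q| = |x|, so that |1/x - 1/q| = |x - q|/|x|^2, which the second bound
   makes smaller than [e]. *)
have m_gt0 : 0 < Num.min (abs x) (e * (abs x * abs x)).
  by rewrite lt_min ax0 !mulr_gt0.
have [q] := xQ _ m_gt0; rewrite lt_min => /andP [xq1 xq2]; exists q^-1.
have aq : abs (ratr q) = abs x by apply: abs_eq_of_lt; rewrite absBC.
have q0 : ratr q != 0 :> K by rewrite -abs_eq0 aq abs_eq0.
rewrite ratr_inv (_ : _ - _ = (ratr q - x) / (x * ratr q)).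
  by rewrite absM absV absM aq ltr_pdivrMr ?mulr_gt0 // absBC.
by field; rewrite q0.
Qed.

Lemma Qp_subring : is_subring Qp.
Proof. by split; [exact: Qp_nat 1%N|exact: QpB|exact: QpM]. Qed.

Lemma Zp_subring : is_subring Zp.
Proof.
split=> [|x y [Qx x1] [Qy y1]|x y [Qx x1] [Qy y1]]; split.
- exact: Qp_nat 1%N.
- by rewrite abs1.
- exact: QpB.
- exact: absB_le.
- exact: QpM.
- by rewrite absM mulr_ile1 ?abs_ge0.
Qed.

Lemma Zp_cong C x y :
  cong Zp p C x y <-> Qp (x - y) /\ abs (x - y) <= abs p%:R ^+ C.
Proof.
have pQ := subringX Qp_subring C (Qp_nat p).
split=> [[z [Qz z1] ->]|[Qxy xy]].
  split; first exact: QpM.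
  by rewrite absM absX ler_piMr // exprn_ge0 // ltW ?abs_p_gt0.
exists ((p%:R ^+ C)^-1 * (x - y)); last by rewrite mulrA mulfV ?mul1r ?pXK_neq0.
split; first by apply: QpM => //; apply: QpV.
by rewrite absM absV absX mulrC ler_pdivrMr ?mul1r // exprn_gt0 // abs_p_gt0.
Qed.

(** Completeness is assumed for sequences of rationals only; u_n is replaced by a rational at
    distance less than 1/(n+1). *)
Lemma Qp_complete u : (forall n, Qp (u n)) -> abs_cauchy abs u ->
  exists2 x, Qp x & abs_cvg abs u x.
Proof.
move=> Qu cu; have inv_gt0 n : 0 < n.+1%:R^-1 :> R by rewrite invr_gt0.
pose q n := projT1 (cid ((QpP _).1 (Qu n) _ (inv_gt0 n))).
have uq e : 0 < e -> exists N, forall n, (N <= n)%N -> abs (u n - ratr (q n)) < e.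
  move=> e0; have [N _ HN] := near_infty_natSinv_lt (PosNum e0).
  by exists N => n /HN /=; apply: lt_trans; rewrite /q; case: (cid _).
have [x qx] : exists x, abs_cvg abs (fun n => ratr (q n)) x.
  apply: (Qp_alg_complete K_Qp_alg) => e e0.
  have [N HN] := uq e e0; have [N' HN'] := cu e e0.
  exists (maxn N N') => m n; rewrite !geq_max => /andP [mN mN'] /andP [nN nN'].
  have -> : ratr (q m) - ratr (q n) =
      (u m - u n) - (u m - ratr (q m)) + (u n - ratr (q n)) :> K by ring.
  by apply: absD_lt; [apply: absB_lt; [exact: HN'|exact: HN]|exact: HN].
exists x; first by exists q.
apply/abs_cvgP => e e0; have [N HN] := uq e e0.
have [N' HN'] := (abs_cvgP _ _).1 qx e e0; exists (maxn N N') => n.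
rewrite geq_max => /andP [nN nN'].
rewrite (_ : _ - _ = (u n - ratr (q n)) + (ratr (q n) - x)); last by ring.
by apply: absD_lt; [exact: HN|exact: HN'].
Qed.

(** Fermat's little theorem is obtained by showing that its solutions in Z_p form a subring, which
    therefore contains the integers. *)
Definition frobenius_fixed (x : K) := Zp x /\ cong Zp p 1 (x ^+ p) x.

Lemma frobenius_fixed_subring : is_subring frobenius_fixed.
Proof.
have fD x y : frobenius_fixed x -> frobenius_fixed y -> frobenius_fixed (x + y).
  move=> [Zx xp] [Zy yp]; split; first exact: (subringD Zp_subring).
  apply: (cong_trans Zp_subring) (cong_freshman Zp_subring p_prime Zx Zy) _.
  exact: (congD Zp_subring).
have fN x : frobenius_fixed x -> frobenius_fixed (- x).
  move=> [Zx xp]; split; first exact: (subringN Zp_subring).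
  (* Expanding 0 = (x + (-x))^p gives (-x)^p congruent to -x^p, without distinguishing the parity of
     [p]. *)
  have := cong_freshman Zp_subring p_prime Zx (subringN Zp_subring Zx).
  rewrite subrr expr0n gtn_eqF ?prime_gt0 // => h.
  have := congB Zp_subring (cong_sym Zp_subring h) xp.
  by rewrite addrAC subrr add0r sub0r.
split=> [|x y fx fy|x y [Zx xp] [Zy yp]]; last 1 first.
- split; first exact: (subringM Zp_subring).
  by rewrite exprMn; apply: (congM Zp_subring) => //; apply: (subringX Zp_subring).
- split; first exact: (subring1 Zp_subring).
  by rewrite expr1n; exact: (cong_refl Zp_subring).
- by apply: fD => //; apply: fN.
Qed.

(** Modulo p, x is a rational number with denominator prime to p, and Fermat's theorem applies to
    its numerator and denominator. *)
Lemma Zp_frobenius x : Zp x -> cong Zp p 1 (x ^+ p) x.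
Proof.
have fint (z : int) : frobenius_fixed z%:~R.
  case: z => n; first exact: (subring_nat frobenius_fixed_subring).
  rewrite NegzE mulrNz; apply: (subringN frobenius_fixed_subring).
  exact: (subring_nat frobenius_fixed_subring).
move=> Zx; case: (Zx) => Qx x1.
have [q xq] := (QpP x).1 Qx _ abs_p_gt0.
have q1 : abs (ratr q) <= 1.
  rewrite -[ratr q](subrK x); apply: absD_le => //.
  by rewrite absBC (le_trans (ltW xq)) // ltW ?abs_p_lt1.
have Zq : Zp (ratr q) by split => //; exact: Qp_ratr.
have xq_cong : cong Zp p 1 x (ratr q).
  by apply/Zp_cong; split; [exact: QpB (Qp_ratr q)|rewrite expr1 ltW].
suff qp : cong Zp p 1 (ratr q ^+ p) (ratr q).
  apply: (cong_trans Zp_subring) (congX Zp_subring _ Zx Zq xq_cong) _.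
  by apply: (cong_trans Zp_subring) qp _; apply: (cong_sym Zp_subring).
(* Were the denominator divisible by p, the numerator would be a unit and |q| would exceed 1. *)
have d1 : abs (denq q)%:~R = 1.
  apply: abs_int_eq1; apply/negP => p_d.
  have p_n : ~~ (p %| numq q)%Z.
    apply/negP => p_n; have := coprime_num_den q; rewrite /coprime => /eqP g1.
    have : (p %| gcdn `|numq q| `|denq q|)%N.
      by rewrite dvdn_gcd; move: p_n p_d; rewrite !dvdzE /= => -> ->.
    by rewrite g1 dvdn1; case: p p_prime => [|[]].
  move: q1; rewrite ratr_num_den absM absV abs_int_eq1 // mul1r.
  rewrite leNgt invf_gt1 ?(le_lt_trans (abs_int_dvd p_d)) ?abs_p_lt1 //.
  by rewrite abs_gt0 intK_neq0 ?denq_neq0.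
have [[Zn np] [Zd dp]] := (fint (numq q), fint (denq q)).
have d0 : (denq q)%:~R != 0 :> K by rewrite intK_neq0 ?denq_neq0.
have Zdv : Zp ((denq q)%:~R)^-1.
  by split; [exact: QpV Zd.1|rewrite absV d1 invr1].
rewrite ratr_num_den exprMn; apply: (congM Zp_subring) => //.
  exact: (subringX Zp_subring).
set d := (denq q)%:~R in d0 Zd dp Zdv *.
(* Multiplying d^p = d modulo p by the integral factor d^(-p-1) gives the congruence for the inverse
   of [d]. *)
have e1 : d^-1 ^+ p = d^-1 ^+ p * d^-1 * d by rewrite mulfVK.
have e2 : d^-1 = d^-1 ^+ p * d^-1 * d ^+ p.
  by rewrite mulrAC -exprMn mulVf // expr1n mul1r.
rewrite e1 [X in cong _ _ _ _ X]e2; apply: (congMl Zp_subring).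
  by apply: (subringM Zp_subring) => //; apply: (subringX Zp_subring).
exact: (cong_sym Zp_subring).
Qed.

(** * Finite-dimensional spaces over Q_p *)

(** The coefficients range over an arbitrary set, so that both Q_p-spans and combinations with
    bounded coefficients are covered. *)
Fixpoint span (D : set K) (s : seq K) (y : K) : Prop :=
  if s is x :: s' then exists2 c, D c & span D s' (y - c * x) else y = 0.

Lemma span_min (D V : set K) s : V 0 -> (forall x y, V x -> V y -> V (x + y)) ->
    (forall c x, D c -> x \in s -> V (c * x)) ->
  forall y, span D s y -> V y.
Proof.
move=> V0 VD; elim: s => [_ y ->|x s IHs Vs y [c Dc sy]] //.
rewrite -[y](subrK (c * x)); apply: VD; last by apply: Vs; rewrite // mem_head.
by apply: IHs sy => c' x' Dc' x's; apply: Vs; rewrite // in_cons x's orbT.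
Qed.

Lemma spanB s x y : span Qp s x -> span Qp s y -> span Qp s (x - y).
Proof.
elim: s x y => [|z s IHs] x y; first by move=> -> ->; rewrite subr0.
move=> [c Qc sx] [d Qd sy]; exists (c - d); first exact: (subringB Qp_subring).
rewrite (_ : _ - _ = x - c * z - (y - d * z)); first exact: IHs.
by ring.
Qed.

Lemma span0 s : span Qp s 0.
Proof.
elim: s => [|z s IHs] //; exists 0; first exact: (subring0 Qp_subring).
by rewrite mul0r subr0.
Qed.

Lemma spanD s x y : span Qp s x -> span Qp s y -> span Qp s (x + y).
Proof.
move=> sx sy; rewrite -[y]opprK; apply: spanB => //; rewrite -sub0r.
by apply: spanB => //; apply: span0.
Qed.

Lemma spanZ s c x : Qp c -> span Qp s x -> span Qp s (c * x).
Proof.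
move=> Qc; elim: s x => [|z s IHs] x; first by move=> ->; rewrite /= mulr0.
move=> [d Qd sx]; exists (c * d); first exact: (subringM Qp_subring).
by rewrite -mulrA -mulrBr; apply: IHs.
Qed.

Lemma mem_span s x : x \in s -> span Qp s x.
Proof.
elim: s => [|z s IHs] //; rewrite in_cons => /predU1P [->|/IHs sx].
  exists 1; first exact: (subring1 Qp_subring).
  by rewrite mul1r subrr; apply: span0.
exists 0; first exact: (subring0 Qp_subring).
by rewrite mul0r subr0.
Qed.

Lemma span_sum s (I : Type) (r : seq I) (Q : pred I) (F : I -> K) :
  (forall i, Q i -> span Qp s (F i)) -> span Qp s (\sum_(i <- r | Q i) F i).
Proof.
by move=> sF; elim/big_ind: _ => //; [exact: span0|move=> *; exact: spanD].
Qed.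

Definition complete (V : set K) := forall u : nat -> K,
  (forall n, V (u n)) -> abs_cauchy abs u -> exists2 l, V l & abs_cvg abs u l.

Lemma abs_cvg_cauchy u l : abs_cvg abs u l -> abs_cauchy abs u.
Proof.
move=> /abs_cvgP ul e e0; have [N HN] := ul e e0.
exists N => m n mN nN; rewrite (_ : _ - _ = (u m - l) - (u n - l)); last by ring.
by apply: absB_lt; apply: HN.
Qed.

Lemma complete_closed V u l : complete V -> (forall n, V (u n)) ->
  abs_cvg abs u l -> V l.
Proof.
move=> cV Vu ul; have [l' Vl' ul'] := cV _ Vu (abs_cvg_cauchy ul).
by rewrite (abs_cvg_unique ul ul').
Qed.

(** Otherwise elements of [V] at distance less than 1/(n+1) from [x] would converge to [x], and a
    complete set is closed. *)
Lemma complete_dist V x : complete V -> ~ V x ->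
  exists2 d, 0 < d & forall w, V w -> d <= abs (x - w).
Proof.
move=> cV nVx; apply: contrapT => far; apply: nVx.
have near_x n : exists w, V w /\ abs (x - w) < n.+1%:R^-1.
  apply: contrapT => no; apply: far; exists n.+1%:R^-1.
    by rewrite invr_gt0.
  by move=> w Vw; rewrite leNgt; apply/negP => xw; apply: no; exists w.
pose u n := projT1 (cid (near_x n)).
apply: (complete_closed cV (u := u)) => [n|].
  by rewrite /u; case: (cid _) => ? [].
apply/abs_cvgP => e e0.
have [N _ HN] := near_infty_natSinv_lt (PosNum e0).
exists N => n /HN /=; apply: lt_trans.
by rewrite absBC /u; case: (cid _) => ? [].
Qed.

Lemma span_cons_mem x s : span Qp s x ->
  forall y, span Qp (x :: s) y <-> span Qp s y.
Proof.
move=> sx y; split=> [[c Qc sy]|sy].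
  by rewrite -[y](subrK (c * x)); apply: spanD => //; apply: spanZ.
by exists 0; [exact: (subring0 Qp_subring)|rewrite mul0r subr0].
Qed.

(** Dividing by [c] reduces to the distance from [x] to the span. Thus the coordinate along [x] is
    controlled by the absolute value of the vector. *)
Lemma span_cons_dist x s d : 0 < d ->
    (forall w, span Qp s w -> d <= abs (x - w)) ->
  forall c w, Qp c -> span Qp s w -> abs c * d <= abs (c * x + w).
Proof.
move=> d0 dP c w Qc sw; have [->|c0] := eqVneq c 0.
  by rewrite abs0 mul0r abs_ge0.
have -> : c * x + w = c * (x - (- c^-1) * w).
  by rewrite mulrBr mulNr mulrN opprK mulVKf.
rewrite absM ler_wpM2l ?abs_ge0 //; apply: dP; apply: spanZ => //.
by apply: (subringN Qp_subring); apply: QpV.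
Qed.

(* Finite-dimensional spaces are complete, by adjoining one vector at a time:
   a vector outside a complete space has positive distance to it. *)
Lemma span_complete s : complete (span Qp s).
Proof.
elim: s => [|x s IHs] u su cu.
  exists 0 => //; apply/abs_cvgP => e e0; exists 0%N => n _.
  by rewrite su subrr abs0.
have [sx|nsx] := pselect (span Qp s x).
  have [l sl ul] := IHs u (fun n => (span_cons_mem sx _).1 (su n)) cu.
  by exists l => //; apply/(span_cons_mem sx).
have [d d0 dP] := complete_dist IHs nsx.
have dist := span_cons_dist d0 dP.
pose c n := projT1 (cid2 (su n)).
have Qc n : Qp (c n) by rewrite /c; case: (cid2 _).
have sw n : span Qp s (u n - c n * x) by rewrite /c; case: (cid2 _).
have [l Ql cl] : exists2 l, Qp l & abs_cvg abs c l.
  apply: Qp_complete => // e e0.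
  have [N HN] := cu _ (mulr_gt0 e0 d0); exists N => m n mN nN.
  rewrite -(ltr_pM2r d0); apply: le_lt_trans (HN m n mN nN).
  have -> : u m - u n =
      (c m - c n) * x + ((u m - c m * x) - (u n - c n * x)) by ring.
  by apply: dist; [exact: (subringB Qp_subring)|exact: spanB].
have x1_gt0 : 0 < abs x + 1 by rewrite ltr_wpDl ?abs_ge0.
have clx : abs_cvg abs (fun n => c n * x) (l * x).
  apply/abs_cvgP => e e0.
  have [N HN] := (abs_cvgP _ _).1 cl _ (divr_gt0 e0 x1_gt0).
  exists N => n /HN; rewrite -mulrBl absM ltr_pdivlMr //; apply: le_lt_trans.
  by rewrite ler_wpM2l ?abs_ge0 // lerDl.
have [w sw' wl] :
    exists2 w, span Qp s w & abs_cvg abs (fun n => u n - c n * x) w.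
  apply: IHs => // e e0; have [N HN] := cu e e0.
  have [N' HN'] := abs_cvg_cauchy clx e0; exists (maxn N N') => m n.
  rewrite !geq_max => /andP [mN mN'] /andP [nN nN'].
  rewrite (_ : _ - _ = (u m - u n) - (c m * x - c n * x)); last by ring.
  by apply: absB_lt; [exact: HN|exact: HN'].
exists (w + l * x); first by exists l; rewrite ?addrK.
apply/abs_cvgP => e e0.
have [N HN] := (abs_cvgP _ _).1 clx _ e0.
have [N' HN'] := (abs_cvgP _ _).1 wl _ e0.
exists (maxn N N') => n; rewrite geq_max => /andP [nN nN'].
rewrite (_ : _ - _ = (u n - c n * x - w) + (c n * x - l * x)); last by ring.
by apply: absD_lt; [exact: HN'|exact: HN].
Qed.

(** A form of the equivalence of norms in finite dimension: small vectors are combinations with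
    small coefficients, with a constant independent of the vector. *)
Lemma span_ball s : exists2 d, 0 < d & forall r y, 0 <= r -> span Qp s y ->
  abs y <= d * r -> span (fun c => Qp c /\ abs c <= r) s y.
Proof.
elim: s => [|x s [d d0 dP]]; first by exists 1.
have [sx|nsx] := pselect (span Qp s x).
  exists d => // r y r0 /(span_cons_mem sx) sy yr; exists 0.
    by split; [exact: (subring0 Qp_subring)|rewrite abs0].
  by rewrite mul0r subr0; apply: dP.
have [d' d'0 d'P] := complete_dist (@span_complete s) nsx.
have dist := span_cons_dist d'0 d'P.
have x1_gt0 : 0 < abs x + 1 by rewrite ltr_wpDl ?abs_ge0.
(* The bound by d' gives |c| <= r; the bound by d d'/(|x| + 1) gives |c x| <= d r, so the induction
   hypothesis applies to y - c x. *)
pose d1 := Num.min d (Num.min d' (d * d' / (abs x + 1))).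
have d1_gt0 : 0 < d1 by rewrite !lt_min d0 d'0 /= !mulr_gt0 ?invr_gt0.
exists d1 => // r y r0 [c Qc sy] yr.
have cy : abs c * d' <= abs y.
  by rewrite -[y](subrK (c * x)) addrC; apply: dist.
have d1d : d1 <= d by rewrite ge_min lexx.
have d1d' : d1 <= d' by rewrite !ge_min lexx orbT.
have d1dd' : d1 * (abs x + 1) <= d * d'.
  by rewrite -ler_pdivlMr // !ge_min lexx !orbT.
have cr : abs c <= r.
  rewrite -(ler_pM2r d'0) (le_trans cy) // (le_trans yr) // mulrC.
  by rewrite ler_wpM2l.
exists c => //; apply: dP => //; apply: absB_le.
  by rewrite (le_trans yr) // ler_wpM2r.
rewrite absM -(ler_pM2r d'0) mulrAC.
have h1 : abs c * d' * abs x <= d1 * r * abs x.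
  by rewrite ler_wpM2r ?abs_ge0 // (le_trans cy).
rewrite (le_trans h1) // (_ : _ * _ * d' = d * d' * r); last by ring.
rewrite mulrAC ler_wpM2r // (le_trans _ d1dd') // ler_wpM2l ?(ltW d1_gt0) //.
by rewrite lerDl.
Qed.

(** [t] is algebraic over Q_p, so the products of elements of [s] with the powers of [t] below its
    degree span a ring. The explicit form of the generators later places them in Z_p[t]. *)
Lemma span_adjoin s t : is_subring (span Qp s) -> exists s',
  [/\ is_subring (span Qp s'), forall x, span Qp s x -> span Qp s' x,
      span Qp s' t &
      forall x, x \in s' -> exists x0 j, x0 \in s /\ x = x0 * t ^+ j].
Proof.
move=> subs; have [f [f0 Qf ft]] := Qp_alg_algebraic K_Qp_alg t.
pose d := (size f).-1; pose c j := - (f`_j / lead_coef f).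
have td : t ^+ d = \sum_(j < d) c j * t ^+ j.
  move: ft; rewrite /root horner_coef.
  have -> : size f = d.+1 by rewrite prednK // size_poly_gt0.
  rewrite big_ord_recr /= addr_eq0 => /eqP e.
  have l0 : lead_coef f != 0 by rewrite lead_coef_eq0.
  apply: (mulfI l0); rewrite [LHS](_ : _ = f`_d * t ^+ d) // -[LHS]opprK -e.
  rewrite -sumrN mulr_sumr; apply: eq_bigr => j _.
  by rewrite /c; field.
have Qc j : Qp (c j).
  apply: (subringN Qp_subring); apply: (subringM Qp_subring) => //.
  by apply: QpV; rewrite lead_coefE.
pose s' := [seq x * t ^+ j | x <- s, j <- iota 0 d].
have s'X k x : x \in s -> span Qp s' (x * t ^+ k).
  move=> xs; elim/ltn_ind: k => k IHk; have [lt_kd|le_dk] := ltnP k d.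
    apply: mem_span; apply/allpairsP; exists (x, k); split => //=.
    by rewrite mem_iota.
  rewrite -(subnK le_dk) exprD td mulr_sumr mulr_sumr; apply: span_sum => j _.
  have -> : x * (t ^+ (k - d) * (c j * t ^+ j)) = c j * (x * t ^+ (k - d + j)).
    by rewrite exprD (mulrCA (t ^+ _)) (mulrCA x).
  by apply: spanZ => //; apply: IHk; have := ltn_ord j; lia.
have sX k z : span Qp s z -> span Qp s' (z * t ^+ k).
  apply: (span_min (V := fun z => span Qp s' (z * t ^+ k))).
  - by rewrite mul0r; apply: span0.
  - by move=> x y sx sy; rewrite mulrDl; apply: spanD.
  - by move=> b x Qb xs; rewrite -mulrA; apply: spanZ => //; apply: s'X.
have s'M x y : x \in s' -> y \in s' -> span Qp s' (x * y).
  move=> /allpairsP [[x0 i] [/= xs _ ->]] /allpairsP [[y0 j] [/= ys _ ->]].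
  rewrite mulrACA -exprD; apply: sX.
  by apply: (subringM subs); apply: mem_span.
have ss' x : span Qp s x -> span Qp s' x.
  by move=> sx; rewrite -[x]mulr1 -(expr0 t); apply: sX.
exists s'; split => //.
- split; first by apply: ss'; apply: (subring1 subs).
    by move=> x y; apply: spanB.
  move=> x y; apply: (span_min (V := fun x => span Qp s' y -> span Qp s' (x * y))).
  + by move=> _; rewrite mul0r; apply: span0.
  + by move=> x1 x2 h1 h2 sy; rewrite mulrDl; apply: spanD; [exact: h1|exact: h2].
  move=> b x1 Qb x1s; rewrite -mulrA => sy; apply: spanZ => //; move: sy.
  apply: (span_min (V := fun y => span Qp s' (x1 * y))).
  + by rewrite mulr0; apply: span0.
  + by move=> y1 y2 h1 h2; rewrite mulrDr; apply: spanD.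
  by move=> b' y1 Qb' y1s; rewrite mulrCA; apply: spanZ => //; apply: s'M.
- by rewrite -[t]mul1r -[t in _ * t]expr1; apply: sX; apply: (subring1 subs).
- by move=> x /allpairsP [[x0 j] [xs _ ->]]; exists x0, j.
Qed.

Lemma span1_subring : is_subring (span Qp [:: 1]).
Proof.
have s1P x : span Qp [:: 1] x <-> Qp x.
  split=> [[c Qc /eqP]|Qx]; last by exists x; rewrite // mulr1 subrr.
  by rewrite mulr1 subr_eq0 => /eqP ->.
by split=> [|x y /s1P Qx /s1P Qy|x y /s1P Qx /s1P Qy]; apply/s1P;
  [exact: (subring1 Qp_subring)|exact: (subringB Qp_subring)|
   exact: (subringM Qp_subring)].
Qed.


(** * Dwork's lemma in Z_p[X] and the bracket Witt vectors *)

Definition polyZp (f : {poly K}) : Prop := forall i, Zp f`_i.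

Lemma polyZp_subring : is_subring polyZp.
Proof.
split=> [i|f g Zf Zg i|f g Zf Zg i].
- by rewrite coef1; apply: (subring_nat Zp_subring).
- by rewrite coefB; apply: (subringB Zp_subring).
- rewrite coefM; apply: (subring_sum Zp_subring) => j _.
  exact: (subringM Zp_subring).
Qed.

Lemma polyZpC c : Zp c -> polyZp c%:P.
Proof.
move=> Zc i; rewrite coefC; case: eqP => // _; exact: (subring0 Zp_subring).
Qed.

Lemma polyZpX : polyZp 'X.
Proof. by move=> i; rewrite coefX; apply: (subring_nat Zp_subring). Qed.

Lemma polyZp_MXaddC f c : polyZp (f * 'X + c%:P) -> polyZp f /\ Zp c.
Proof.
move=> Z; split=> [i|]; first by have := Z i.+1; rewrite coefD coefMX coefC addr0.
by have := Z 0%N; rewrite coefD coefMX coefC add0r.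
Qed.

Lemma polyZp_comp f Q : polyZp f -> polyZp Q -> polyZp (f \Po Q).
Proof.
move=> Zf ZQ; elim/poly_ind: f Zf => [|f c IHf] Zf; first by rewrite comp_poly0.
have [Zf' Zc] := polyZp_MXaddC Zf.
rewrite comp_polyD comp_polyM comp_polyX comp_polyC.
apply: (subringD polyZp_subring); last exact: polyZpC.
by apply: (subringM polyZp_subring) => //; apply: IHf.
Qed.

(** f(Q) = f(X^p) = f(X)^p modulo p: the first equality is the hypothesis on [Q], the second the
    freshman's dream with Fermat's theorem for the coefficients. Horner induction handles both at
    once. *)
Lemma comp_frobenius f Q : polyZp f -> polyZp Q -> cong polyZp p 1 Q 'X^p ->
  cong polyZp p 1 (f \Po Q) (f ^+ p).
Proof.
move=> Zf ZQ Qp; have polyZp_subring := polyZp_subring.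
elim/poly_ind: f Zf => [|f c IHf] Zf.
  rewrite comp_poly0 expr0n gtn_eqF ?prime_gt0 //; exact: cong_refl.
have [Zf' Zc] := polyZp_MXaddC Zf.
rewrite comp_polyD comp_polyM comp_polyX comp_polyC.
have ZfX : polyZp (f * 'X).
  by apply: (subringM polyZp_subring) => //; exact: polyZpX.
have fr := cong_freshman polyZp_subring p_prime ZfX (polyZpC Zc).
apply: (cong_trans polyZp_subring) (cong_sym polyZp_subring fr).
apply: (congD polyZp_subring).
  rewrite exprMn; apply: (congM polyZp_subring) => //; last exact: IHf.
    exact: polyZp_comp.
  exact: (subringX polyZp_subring) polyZpX.
apply: (cong_sym polyZp_subring); have [z Zz e] := Zp_frobenius Zc.
exists z%:P; first exact: polyZpC.
by rewrite -polyC_exp -polyCB e polyCM polyC_exp polyCMn.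
Qed.

Section Dwork.
Variable Q : {poly K}.
Hypotheses (ZQ : polyZp Q) (Q_frob : cong polyZp p 1 Q 'X^p).

(** [Q] is substituted on the inside, so that the step from n to n+1 applies a ring homomorphism to
    the n-th phantom identity. *)
Definition iter_comp (n : nat) : {poly K} := iter n (fun f => f \Po Q) 'X.

Lemma horner_iter_comp n x : (iter_comp n).[x] = iter n (horner Q) x.
Proof.
elim: n x => [|n IHn] x; first by rewrite hornerX.
by rewrite horner_comp IHn iterSr.
Qed.

Let pinv : {poly K} := (p%:R^-1)%:P.

Let pinvK : pinv * p%:R = 1.
Proof. by rewrite -polyC1 -polyCMn -polyCM mulVf ?pK_neq0. Qed.

Definition dwork_witt : nat -> {poly K} := witt_of_ghost p pinv iter_comp.

Lemma dwork_witt_ghost n :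
  \sum_(i < n.+1) p%:R ^+ i * dwork_witt i ^+ (p ^ (n - i)) = iter_comp n.
Proof. exact: witt_of_ghostP. Qed.

(** Dwork's lemma. Substituting [Q] in the phantom identity of index n gives summands p^i
    lambda_i(Q)^(p^(n-i)). Raising lambda_i(Q) = lambda_i^p modulo p to the power p^(n-i) makes them
    agree with p^i lambda_i^(p^(n+1-i)) modulo p^(n+1), so p^(n+1) lambda_(n+1) is divisible by
    p^(n+1). *)
Lemma dwork_witt_integral n : polyZp (dwork_witt n).
Proof.
have polyZp_subring := polyZp_subring.
elim/ltn_ind: n => n IHn.
have [z Zz] : cong polyZp p n (iter_comp n)
    (\sum_(i < n) p%:R ^+ i * dwork_witt i ^+ (p ^ (n - i))).
  case: n IHn => [|n] IHn.
    by exists 'X; rewrite ?big_ord0 ?subr0 ?mul1r //; exact: polyZpX.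
  rewrite [iter_comp _]/= -/(iter_comp n) -dwork_witt_ghost raddf_sum /=.
  apply: (cong_sum polyZp_subring) => i.
  have le_in : (i <= n)%N by rewrite -ltnS.
  rewrite comp_polyM !rmorphXn /= rmorph_nat.
  have Zi := IHn i (ltn_ord i).
  have h := comp_frobenius Zi ZQ Q_frob.
  have := cong_exppX polyZp_subring p_prime (n - i) (polyZp_comp Zi ZQ)
            (subringX polyZp_subring p Zi) h.
  rewrite add0n -exprM -expnS -subSn // => /(congMpX i).
  by rewrite subSn // addnS subnKC.
rewrite -dwork_witt_ghost big_ord_recr /= subnn expr1 addrAC subrr add0r.
move=> /(congr1 (fun f => pinv ^+ n * f)).
by rewrite !mulrA -!exprMn pinvK expr1n !mul1r => ->.
Qed.

End Dwork.

Lemma Zp_adjoin_subring a : is_subring (Zp_adjoin abs a).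
Proof.
have polyZp_subring := polyZp_subring.
split=> [|x y [f Zf ->] [g Zg ->]|x y [f Zf ->] [g Zg ->]].
- by exists 1; [exact: (subring1 polyZp_subring)|rewrite hornerC].
- by exists (f - g); [exact: (subringB polyZp_subring)|rewrite !hornerE].
- by exists (f * g); [exact: (subringM polyZp_subring)|rewrite hornerM].
Qed.

Lemma Zp_adjoin_gen a : Zp_adjoin abs a a.
Proof. by exists 'X; [exact: polyZpX|rewrite hornerX]. Qed.

Lemma Zp_adjoin_Zp a c : Zp c -> Zp_adjoin abs a c.
Proof. by move=> Zc; exists c%:P; [exact: polyZpC|rewrite hornerC]. Qed.

Lemma horner_subring (A : set K) (f : {poly K}) x :
  is_subring A -> (forall i, A f`_i) -> A x -> A f.[x].
Proof.
move=> subA Af Ax; rewrite horner_coef; apply: (subring_sum subA) => i _.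
by apply: (subringM subA) => //; apply: (subringX subA).
Qed.

Lemma horner_cong (A : set K) C (f : {poly K}) x y :
  is_subring A -> (forall i, A f`_i) -> A x -> A y ->
  cong A p C x y -> cong A p C f.[x] f.[y].
Proof.
move=> subA Af Ax Ay xy; rewrite !horner_coef; apply: (cong_sum subA) => i.
by apply: (congMl subA) => //; apply: (congX subA).
Qed.

(** The span is Q_p[a]; generators inside Z_p[a] are needed to compare its topology with
    divisibility by p in Z_p[a]. *)
Lemma adjoin_span a : exists s, [/\ is_subring (span Qp s), span Qp s a,
  forall c, Qp c -> span Qp s c & forall x, x \in s -> Zp_adjoin abs a x].
Proof.
have [s [subs s1 sa sP]] := span_adjoin a span1_subring.
exists s; split=> // [c Qc|x /sP [x0 [j []]]].
  by apply: s1; exists c; rewrite // mulr1 subrr.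
rewrite inE => /eqP -> ->; rewrite mul1r; apply: (subringX (Zp_adjoin_subring a)).
exact: Zp_adjoin_gen.
Qed.

(** By [span_ball], a small element has coordinates divisible by p^C in Z_p, and the generators lie
    in Z_p[a]. *)
Lemma span_Zp_adjoin a s C : is_subring (span Qp s) ->
    (forall x, x \in s -> Zp_adjoin abs a x) ->
  exists2 d, 0 < d & forall y, span Qp s y -> abs y < d ->
    cong (Zp_adjoin abs a) p C y 0.
Proof.
move=> subs sA; have subA := Zp_adjoin_subring a.
have [d d0 dP] := span_ball s.
have pC0 : 0 < abs p%:R ^+ C by rewrite exprn_gt0 // abs_p_gt0.
exists (d * abs p%:R ^+ C) => [|y sy /ltW yd]; first exact: mulr_gt0.
have {yd} := dP _ _ (ltW pC0) sy yd.
apply: (span_min (V := fun y => cong (Zp_adjoin abs a) p C y 0)).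
- exact: (cong_refl subA).
- by move=> x1 x2 h1 h2; rewrite -[0]addr0; apply: (congD subA).
move=> c x [Qc cC] xs; have : cong Zp p C c 0 by apply/Zp_cong; rewrite subr0.
move=> [z Zz]; rewrite subr0 => ->; exists (z * x); last by rewrite subr0 mulrA.
by apply: (subringM subA); [exact: Zp_adjoin_Zp|exact: sA].
Qed.

Lemma abs_cvg_bounded_index (u : nat -> nat -> K) (l : nat -> K) m e : 0 < e ->
    (forall n, abs_cvg abs (u n) (l n)) ->
  exists N, forall n k, (n <= m)%N -> (N <= k)%N -> abs (u n k - l n) < e.
Proof.
move=> e0 ul; pose g n := projT1 (cid ((abs_cvgP _ _).1 (ul n) e e0)).
exists (\max_(n < m.+1) g n) => n k le_nm le_k.
have : (g n <= k)%N.
  apply: leq_trans le_k.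
  exact: (@leq_bigmax _ (fun i : 'I_m.+1 => g i) (Ordinal (le_nm : n < m.+1)%N)).
by rewrite /g; case: (cid _) => /= N; apply.
Qed.

(** * Integrality of the bracket Witt vectors *)

Section Bracket.
Variable P : fps K.
Hypotheses (P_int : integral_fps abs P) (P_0 : P 0%N = 0).
Hypothesis P_mod_p : fps_eqmod abs p%:R P (fps_Xn K p).
Variable varpi : nat -> K.
Hypothesis varpi_0 : fps_sum abs P (varpi 0%N) 0.
Hypothesis varpi_S : forall j, fps_sum abs P (varpi j.+1) (varpi j).

(** The phantom vector is an orbit of [P]: it reaches 0 after varpi_0 and stays there because P(0) =
    0. *)
Lemma fps_sum_phantom m n :
  fps_sum abs P (phantom_of_seq varpi m n) (phantom_of_seq varpi m n.+1).
Proof.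
rewrite /phantom_of_seq; have [lt_nm|lt_mn|->] := ltngtP n m.
- by rewrite -(subnSK lt_nm); apply: varpi_S.
- apply/abs_cvgP => e e0; exists 0%N => k _; rewrite subr0 big1 ?abs0 // => i _.
  case: (nat_of_ord i) => [|j]; first by rewrite P_0 mul0r.
  by rewrite expr0n mulr0.
- by rewrite subnn.
Qed.

Lemma poly_trunc_integral N : polyZp (\poly_(i < N) P i).
Proof.
move=> i; rewrite coef_poly; case: ifP => // _; exact: (subring0 Zp_subring).
Qed.

Lemma poly_trunc_frobenius N : (p < N)%N ->
  cong polyZp p 1 (\poly_(i < N) P i) 'X^p.
Proof.
move=> lt_pN; have [h Zh hP] := P_mod_p; exists (\poly_(i < N) h i).
  move=> i; rewrite coef_poly; case: ifP => // _; exact: (subring0 Zp_subring).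
apply/polyP => i; rewrite expr1 mulr_natl coefMn coefB coefXn !coef_poly.
case: ltnP => [lt_iN|le_Ni]; first by rewrite -(mulr_natl (h i)) -hP.
by rewrite gtn_eqF ?subr0 ?mul0rn // (leq_trans lt_pN).
Qed.

(** Partial sums of P at a point of the span stay in it, and the span is closed, being complete. *)
Lemma phantom_span m s :
  is_subring (span Qp s) -> (forall c, Qp c -> span Qp s c) ->
  span Qp s (varpi m) -> forall n, span Qp s (phantom_of_seq varpi m n).
Proof.
move=> subs Qs sm; elim=> [|n IHn]; first by rewrite /phantom_of_seq subn0.
apply: (complete_closed (@span_complete s)) (fps_sum_phantom m n) => k.
apply: (subring_sum subs) => i _; apply: (subringM subs).
  by apply: Qs; have [] := P_int i.
exact: (subringX subs).
Qed.

(** Small errors in Q_p[varpi_m] are multiples of p^C in Z_p[varpi_m]. One truncation serves all n: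
    only the finitely many n <= m need approximation, since both sides vanish beyond. *)
Lemma phantom_poly_approx m C : exists Q, [/\ polyZp Q,
  cong polyZp p 1 Q 'X^p & forall n, cong (Zp_adjoin abs (varpi m)) p C
     Q.[phantom_of_seq varpi m n] (phantom_of_seq varpi m n.+1)].
Proof.
set phi := phantom_of_seq varpi m; set A := Zp_adjoin abs (varpi m).
have [s [subs sm Qs sA]] := adjoin_span (varpi m).
have [d d0 dP] := span_Zp_adjoin C subs sA.
have [N HN] := abs_cvg_bounded_index m d0 (fps_sum_phantom m).
(* Degrees up to p are kept, so that the truncation is still congruent to X^p. *)
pose M := maxn N p.+1; exists (\poly_(i < M) P i).
split=> [||n]; first exact: poly_trunc_integral.
  by apply: poly_trunc_frobenius; rewrite leq_maxr.
have sphi := phantom_span subs Qs sm.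
rewrite horner_poly; have subA := Zp_adjoin_subring (varpi m).
have [le_nm|lt_mn] := leqP n m; last first.
  rewrite /phi /phantom_of_seq leqNgt lt_mn /= ifN; last by rewrite -ltnNge ltnW.
  rewrite big1; first exact: (cong_refl subA).
  move=> i _; case: (nat_of_ord i) => [|j]; first by rewrite P_0 mul0r.
  by rewrite expr0n mulr0.
have : cong A p C (\sum_(i < M) P i * phi n ^+ i - phi n.+1) 0.
  apply: dP; last exact: HN (leq_maxl _ _).
  apply: (subringB subs) => //; apply: (subring_sum subs) => i _.
  apply: (subringM subs); last exact: (subringX subs).
  by apply: Qs; have [] := P_int i.
by case=> z Az; rewrite subr0 => e; exists z.
Qed.

Definition bracket (m : nat) : nat -> K :=
  witt_of_ghost p p%:R^-1 (phantom_of_seq varpi m).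

Let pinvK : (p%:R^-1 : K) * p%:R = 1.
Proof. by rewrite mulVf ?pK_neq0. Qed.

Lemma bracket_ghost m n : witt_phantom p (bracket m) n = phantom_of_seq varpi m n.
Proof. exact: witt_of_ghostP. Qed.

(** The Dwork vector of the approximating polynomial, evaluated at varpi_m, is integral and has the
    desired phantom components modulo p^n. By [witt_cong] component n is then known modulo p^(n-n) =
    1, which suffices for membership in Z_p[varpi_m]. *)
Lemma bracket_integral m n : Zp_adjoin abs (varpi m) (bracket m n).
Proof.
set phi := phantom_of_seq varpi m; have subA := Zp_adjoin_subring (varpi m).
have [Q [ZQ Q_frob Qphi]] := phantom_poly_approx m n.
have AQ i : Zp_adjoin abs (varpi m) Q`_i by exact: Zp_adjoin_Zp.
have Aphi i : Zp_adjoin abs (varpi m) (phi i).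
  elim: i => [|i IHi].
    by rewrite /phi /phantom_of_seq subn0; exact: Zp_adjoin_gen.
  apply: (cong_subring subA _ (cong_sym subA (Qphi i))).
  exact: horner_subring.
have Qiter i :
    cong (Zp_adjoin abs (varpi m)) p n (iter_comp Q i).[varpi m] (phi i).
  rewrite horner_iter_comp; elim: i => [|i IHi].
    by rewrite /phi /phantom_of_seq subn0; exact: (cong_refl subA).
  apply: (cong_trans subA) (Qphi i); apply: (horner_cong subA) => //.
  exact: (cong_subring subA) IHi.
pose mu i := (dwork_witt Q i).[varpi m].
have Amu i : Zp_adjoin abs (varpi m) (mu i).
  by exists (dwork_witt Q i) => //; exact: dwork_witt_integral.
apply: (cong_subring subA (Amu n)).
apply: (cong_leq subA (leq0n (n - n)%N)).
apply: (witt_cong subA pinvK Amu _ (leqnn n)) => i le_in.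
rewrite witt_of_ghostP //; apply: (cong_sym subA).
apply: (cong_trans subA) (Qiter i); rewrite -dwork_witt_ghost.
rewrite horner_sum.
have -> : \sum_(j < i.+1) p%:R ^+ j * mu j ^+ (p ^ (i - j)) =
   \sum_(j < i.+1) (p%:R ^+ j * dwork_witt Q j ^+ (p ^ (i - j))).[varpi m].
  by apply: eq_bigr => j _; rewrite hornerM !horner_exp hornerMn hornerC.
exact: (cong_refl subA).
Qed.

End Bracket.

(** * Integrality of the Artin-Hasse exponential *)

Lemma phantom_seriesX (phi : nat -> K) k :
  phantom_series p phi (p ^ k)%N = phi k / (p ^ k)%:R.
Proof.
have lt_k : (k < (p ^ k).+1)%N by rewrite ltnS ltnW // ltn_expl // prime_gt1.
rewrite /phantom_series (big_pred1 (Ordinal lt_k)) // => i.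
by rewrite eqn_exp2l ?prime_gt1.
Qed.

Lemma phantom_series_neqX (phi : nat -> K) n : (forall k, n <> (p ^ k)%N) ->
  phantom_series p phi n = 0.
Proof.
by move=> nX; rewrite /phantom_series big_pred0 // => i; apply/eqP => /esym /nX.
Qed.

Lemma phantom_series0 (phi : nat -> K) : phantom_series p phi 0 = 0.
Proof.
apply: phantom_series_neqX => k /eqP.
by rewrite eq_sym -leqn0 leqNgt expn_gt0 prime_gt0.
Qed.

Definition fps_linear (c : K) : fps K := fun i => if i == 1%N then c else 0.

Lemma phantom_series_mulrp (phi : nat -> K) :
  phantom_series p phi *+ p = fps_linear (p%:R * phi 0%N) +
    fps_comp_monomial (phantom_series p (fun i => phi i.+1)) 1 p.
Proof.
have p_gt1 := prime_gt1 p_prime; have p_gt0 := prime_gt0 p_prime.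
apply/funext => n; rewrite fps_mulrnE fps_addE /fps_linear /fps_comp_monomial.
have [[k ->]|nX] := pselect (exists k, n = (p ^ k)%N).
  rewrite phantom_seriesX; case: k => [|k].
    by rewrite expn0 divr1 eqxx dvdn1 gtn_eqF // addr0 mulr_natl.
  rewrite expnS dvdn_mulr // mulKn // phantom_seriesX expr1n mulr1.
  have -> : (p * p ^ k == 1)%N = false.
    by rewrite gtn_eqF // -expnS (leq_trans _ (ltn_expl _ p_gt1)).
  by rewrite add0r natrM -(mulr_natl (_ / _)); field; rewrite pK_neq0 natrX pXK_neq0.
have {}nX k : n <> (p ^ k)%N by move=> e; apply: nX; exists k.
rewrite phantom_series_neqX // mul0rn ifN; last by apply/eqP; exact: (nX 0%N).
rewrite add0r; case: ifP => // /dvdnP [q en].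
rewrite phantom_series_neqX ?mul0r // => k; rewrite en mulnK // => e.
by apply: (nX k.+1); rewrite en e expnSr.
Qed.

(** A p-th power shifts the phantom vector by one. Constant phi = 1 gives E(T)^p = exp(pT) E(T^p);
    the bracket vectors give the relation between E_(m+1) and E_m. *)
Lemma expo_phantom_exp_p (phi : nat -> K) :
  fps_expo (phantom_series p phi) ^+ p =
  fps_expo (fps_linear (p%:R * phi 0%N)) *
    fps_comp_monomial (fps_expo (phantom_series p (fun i => phi i.+1))) 1 p.
Proof.
have p_gt0 := prime_gt0 p_prime.
rewrite fps_expo_comp_monomial ?phantom_series0 //.
rewrite -fps_expoD; [|exact: natK_neq0|by []|]; last first.
  by rewrite /fps_comp_monomial dvdn0 div0n phantom_series0 mul0r.
rewrite -phantom_series_mulrp fps_expoX //; first exact: natK_neq0.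
exact: phantom_series0.
Qed.

(** The j-th factor is the exponential of the series with terms lambda_j^(p^i) T^(p^(i+j))/p^i.
    Collecting i + j = k and writing 1/p^i as p^j/p^k yields phi_k/p^k. *)
Lemma artin_hasse_exp_expo (lambda : nat -> K) n :
  artin_hasse_exp p lambda n =
  fps_expo (phantom_series p (witt_phantom p lambda)) n.
Proof.
have p_gt1 := prime_gt1 p_prime; have p_gt0 := prime_gt0 p_prime.
have pX_gt0 j : (0 < p ^ j)%N by rewrite expn_gt0 p_gt0.
pose F j := fps_comp_monomial (phantom_series p (fun=> 1 : K)) (lambda j) (p ^ j).
have F0 j : F j 0%N = 0.
  by rewrite /F /fps_comp_monomial dvdn0 div0n phantom_series0 mul0r.
rewrite /artin_hasse_exp fps_prodE.
under eq_bigr => j _ do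
  rewrite /artin_hasse fps_expo_comp_monomial ?phantom_series0 //.
rewrite -(fps_expo_sum natK_neq0 (F := fun j : 'I_n.+1 => F j)) //.
apply: fps_expo_eq => i le_in; rewrite fps_sumE.
have [[k ei]|iX] := pselect (exists k, i = (p ^ k)%N); last first.
  have {}iX k : i <> (p ^ k)%N by move=> e; apply: iX; exists k.
  rewrite phantom_series_neqX // big1 // => j _; rewrite /F /fps_comp_monomial.
  case: ifP => // /dvdnP [q eq]; rewrite phantom_series_neqX ?mul0r // => k.
  by rewrite eq mulnK // => e; apply: (iX (k + j)%N); rewrite eq e expnD.
have le_kn : (k < n.+1)%N.
  by rewrite ltnS (leq_trans _ le_in) // ei ltnW // ltn_expl.
rewrite ei phantom_seriesX /witt_phantom mulr_suml.
rewrite (big_ord_widen _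
  (fun j => p%:R ^+ j * lambda j ^+ (p ^ (k - j)) / (p ^ k)%:R) le_kn).
rewrite [RHS]big_mkcond; apply: eq_bigr => j _.
rewrite /F /fps_comp_monomial ltnS; case: leqP => [le_jk|lt_kj].
  rewrite dvdn_exp2l // -expnB // phantom_seriesX mul1r.
  have -> : ((p ^ k)%:R : K) = p%:R ^+ j * p%:R ^+ (k - j).
    by rewrite -exprD subnKC // natrX.
  have h1 := pXK_neq0 j; have h2 := pXK_neq0 (k - j).
  by rewrite natrX; field; rewrite h1 h2.
by rewrite dvdn_Pexp2l // leqNgt lt_kj.
Qed.

Definition fps_in (A : set K) (f : fps K) : Prop := forall n, A (f n).

Lemma fps_in_subring A : is_subring A -> is_subring (fps_in A).
Proof.
move=> subA; split=> [n|f g Af Ag n|f g Af Ag n].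
- by rewrite fps_oneE; apply: (subring_nat subA).
- by apply: (subringB subA).
- by rewrite fps_mulE; apply: (subring_sum subA) => i _; apply: (subringM subA).
Qed.

Lemma fps_expo_in A f : is_subring A -> (forall c, Qp c -> A c) ->
  fps_in A f -> fps_in A (fps_expo f).
Proof.
move=> subA QA Af n; apply: (subring_sum subA) => k _.
rewrite fps_expE; apply: (subringM subA).
  exact: (subringX (fps_in_subring subA)).
by apply: QA; apply: QpV; apply: Qp_nat.
Qed.

Lemma phantom_series_in A phi : is_subring A -> (forall c, Qp c -> A c) ->
  (forall n, A (phi n)) -> fps_in A (phantom_series p phi).
Proof.
move=> subA QA Aphi n; apply: (subring_sum subA) => k _.
by apply: (subringM subA) => //; apply: QA; apply: QpV; apply: Qp_nat.
Qed.

Lemma fps_comp_monomial_in A f a d : is_subring A -> A a ->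
  fps_in A f -> fps_in A (fps_comp_monomial f a d).
Proof.
move=> subA Aa Af n; rewrite /fps_comp_monomial; case: ifP => _.
  by apply: (subringM subA) => //; apply: (subringX subA).
exact: (subring0 subA).
Qed.

(** * Valuations of factorials and coefficients of exp *)

Lemma logn_fact_rec n : logn p n`! = (n %/ p + logn p (n %/ p)`!)%N.
Proof.
have p_gt1 := prime_gt1 p_prime.
have ext m N : (m <= N)%N -> logn p m`! = (\sum_(1 <= k < N.+1) m %/ p ^ k)%N.
  move=> le_mN; rewrite logn_fact // (big_cat_nat _ (n := m.+1) (p := N.+1)) //=.
  rewrite [X in (_ + X)%N]big_nat_cond [X in (_ + X)%N]big1 ?addn0 // => k.
  case/andP => /andP [lt_mk _] _.
  by rewrite divn_small // (leq_trans lt_mk) // ltnW // ltn_expl.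
case: n => [|n]; first by rewrite div0n fact0 logn1.
rewrite (ext n.+1 n.+1) // big_ltn // expn1; congr addn.
rewrite (ext _ n); last by rewrite -ltnS; apply: ltn_Pdiv.
by rewrite big_add1 /=; apply: eq_bigr => k _; rewrite expnS divnMA.
Qed.

(** Legendre's formula gives n minus the digit sum of n in base p; that sum is at least 1 for n > 0,
    with equality at powers of p, as in [logn_fact_expn]. *)
Lemma logn_fact_le n : ((p - 1) * logn p n`! <= n.-1)%N.
Proof.
have p_gt1 := prime_gt1 p_prime.
elim/ltn_ind: n => n IHn; have [->|n_gt0] := posnP n.
  by rewrite fact0 logn1 muln0.
have [lt_np|le_pn] := ltnP n p.
  by rewrite logn_fact_rec divn_small // fact0 logn1 addn0 muln0.
have q_gt0 : (0 < n %/ p)%N by rewrite divn_gt0 // ltnW.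
have := IHn _ (ltn_Pdiv p_gt1 n_gt0); rewrite [in X in _ -> X]logn_fact_rec.
have := leq_trunc_div n p; rewrite mulnDr mulnBl mul1n mulnC.
by have := leq_pmulr (n %/ p) (ltnW p_gt1); lia.
Qed.

Lemma logn_fact_expn k : ((p - 1) * logn p (p ^ k)`! = (p ^ k).-1)%N.
Proof.
have p_gt0 := prime_gt0 p_prime.
elim: k => [|k IHk]; first by rewrite expn0 logn1 muln0.
rewrite logn_fact_rec expnS mulKn // mulnDr IHk mulnBl mul1n.
have : (0 < p ^ k)%N by rewrite expn_gt0 p_gt0.
by have := leq_pmull (p ^ k) p_gt0; lia.
Qed.

Lemma abs_fact n : abs n`!%:R = (p%:R : R) ^- logn p n`!.
Proof. by rewrite (Qp_alg_abs_nat K_Qp_alg) // fact_gt0. Qed.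

Lemma expo_linearE c n : fps_expo (fps_linear c) n = c ^+ n / n`!%:R.
Proof. exact: fps_expo_monomial. Qed.

(** The power p - 1 avoids the real exponent 1/(p-1) in the radius of convergence of exp. *)
Lemma abs_expo_linearX c n : abs (c ^+ n / n`!%:R) ^+ (p - 1) =
  (abs c ^+ (p - 1)) ^+ n * p%:R ^+ ((p - 1) * logn p n`!).
Proof.
rewrite absM absV absX abs_fact invrK exprMn -!exprM mulnC.
by rewrite [(logn _ _ * _)%N]mulnC.
Qed.

(** Since n! has valuation at most n - 1, exp(pT) is congruent to 1 modulo p. *)
Lemma abs_pX_div_fact n : (0 < n)%N -> abs (p%:R ^+ n / n`!%:R) <= abs p%:R.
Proof.
move=> n_gt0; have := logn_fact_le n; have p_gt1 := prime_gt1 p_prime => h.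
have {h} le_n : (logn p n`! <= n.-1)%N.
  by apply: leq_trans h; rewrite leq_pmull // subn_gt0.
rewrite absM absV absX abs_fact invrK abs_p exprVn.
rewrite -(prednK n_gt0) exprS invfM -mulrA ler_piMr ?invr_ge0 ?ler0n //.
rewrite mulrC ler_pdivrMr ?exprn_gt0 ?pR_gt0 // mul1r.
by rewrite ler_eXn2l ?pR_gt1 // prednK.
Qed.

Definition fps_of_poly (f : {poly K}) : fps K := fun i => f`_i.

Lemma fps_of_polyX f k n : (fps_of_poly f ^+ k) n = (f ^+ k)`_n.
Proof.
elim: k n => [|k IHk] n; first by rewrite !expr0 coef1.
by rewrite !exprS fps_mulE coefM; apply: eq_bigr => i _; rewrite IHk.
Qed.

Lemma artin_hasse_Qp n : Qp (artin_hasse K p n).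
Proof.
apply: (fps_expo_in Qp_subring) => //; apply: (phantom_series_in Qp_subring) => // i.
exact: (subring1 Qp_subring).
Qed.

(* Dwork's criterion: E(T)^p = exp(pT) E(T^p) is congruent to E(T^p) mod p, and
   its T^n coefficient involves e_n only through the summand p e_n. *)
Lemma artin_hasse_integral n : Zp (artin_hasse K p n).
Proof.
have p_gt1 := prime_gt1 p_prime; have p_gt0 := prime_gt0 p_prime.
set e := artin_hasse K p; have e0 : e 0%N = 1 by exact: fps_expo_coef0.
elim/ltn_ind: n => n IHn; split; first exact: artin_hasse_Qp.
case: n IHn => [|n] IHn; first by rewrite e0 abs1.
pose G : {poly K} := \poly_(i < n.+1) e i.
have ZG : polyZp G.
  move=> i; rewrite coef_poly; case: ifP => [/IHn //|_].
  exact: (subring0 Zp_subring).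
pose g := fps_of_poly G.
have eg_ord i : (i < n.+1)%N -> (e - g) i = 0.
  by move=> lt_i; rewrite fps_addE fps_oppE /g /fps_of_poly coef_poly lt_i subrr.
have egn : (e - g) n.+1 = e n.+1.
  by rewrite fps_addE fps_oppE /g /fps_of_poly coef_poly ltnn subr0.
have g0 : g 0%N = 1 by rewrite /g /fps_of_poly coef_poly e0.
have lhs : (e ^+ p) n.+1 = (G ^+ p)`_n.+1 + e n.+1 * p%:R.
  rewrite -fps_of_polyX -/g -[e ^+ p](subrK (g ^+ p)) fps_addE addrC.
  congr (_ + _).
  rewrite subrXX fps_mul_order // egn fps_sumE; congr (_ * _).
  rewrite (eq_bigr (fun=> 1)) ?sumr_const ?card_ord // => i _.
  by rewrite fps_coef0M !fps_coef0X e0 g0 !expr1n mulr1.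
pose E := fps_comp_monomial e 1 p.
have ZE i : (i <= n.+1)%N -> Zp (E i).
  move=> le_i; rewrite /E /fps_comp_monomial; case: ifP => _.
    2: exact: (subring0 Zp_subring).
  rewrite expr1n mulr1; apply: IHn.
  case: i le_i => [|i] le_i; first by rewrite div0n.
  by apply: leq_trans le_i; apply: ltn_Pdiv.
have EG : E n.+1 = (G \Po 'X^p)`_n.+1.
  rewrite coef_comp_poly_Xn // /E /fps_comp_monomial; case: ifP => // _.
  by rewrite expr1n mulr1 coef_poly ltn_Pdiv.
have rhs : abs ((e ^+ p) n.+1 - E n.+1) <= abs p%:R.
  rewrite /e /artin_hasse expo_phantom_exp_p mulr1 -/e -/E.
  rewrite fps_mulE big_ord_recl /= subn0 expo_linearE expr0 fact0 divr1 mul1r.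
  rewrite addrAC subrr add0r; apply: abs_sum_le => [|i _]; first exact: abs_ge0.
  rewrite expo_linearE absM (le_trans _ (abs_pX_div_fact (ltn0Sn i))) //.
  rewrite /bump /= add1n ler_piMr ?abs_ge0 //.
  by have [] := ZE (n.+1 - i.+1)%N (leq_subr _ _).
have GG : abs ((G ^+ p)`_n.+1 - E n.+1) <= abs p%:R.
  have ZXp : polyZp 'X^p by apply: (subringX polyZp_subring); exact: polyZpX.
  have [z Zz ez] := comp_frobenius ZG ZXp (cong_refl polyZp_subring p 1 'X^p).
  rewrite EG absBC -coefB ez expr1 mulr_natl coefMn -(mulr_natl z`_n.+1) absM.
  by rewrite ler_piMr ?abs_ge0 //; have [] := Zz n.+1.
have : abs (e n.+1 * p%:R) <= abs p%:R.
  rewrite (_ : e n.+1 * p%:R = ((e ^+ p) n.+1 - E n.+1) - ((G ^+ p)`_n.+1 - E n.+1)).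
    exact: absB_le.
  by rewrite lhs; ring.
by rewrite absM -ler_pdivlMr ?abs_p_gt0 // divff // gt_eqF ?abs_p_gt0.
Qed.

(** * Exact convergence in the open unit disk *)

Definition vanishing (f : nat -> K) : Prop :=
  forall e, 0 < e -> exists N, forall n, (N <= n)%N -> abs (f n) < e.

Lemma vanishing_bounded f : vanishing f ->
  exists2 B, 0 < B & forall n, abs (f n) <= B.
Proof.
move=> /(_ 1 ltr01) [N HN]; exists (1 + \sum_(i < N) abs (f i)).
  by rewrite ltr_pwDl // sumr_ge0 // => i _; exact: abs_ge0.
move=> n; have [lt_nN|/HN/ltW le1] := ltnP n N.
  rewrite (bigD1 (Ordinal lt_nN)) //= addrCA lerDl addr_ge0 // sumr_ge0 // => i _.
  exact: abs_ge0.
by rewrite (le_trans le1) // lerDl sumr_ge0 // => i _; exact: abs_ge0.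
Qed.

(** For n >= N + M, in each product f_i g_(n-i) one factor is small and the other bounded. *)
Lemma vanishingM (f g : fps K) : vanishing f -> vanishing g -> vanishing (f * g).
Proof.
move=> cf cg e e0; have [A A0 fA] := vanishing_bounded cf.
have [B B0 gB] := vanishing_bounded cg.
have [N HN] := cf _ (divr_gt0 e0 B0); have [M HM] := cg _ (divr_gt0 e0 A0).
exists (N + M)%N => n le_n; rewrite fps_mulE; apply: abs_sum_lt => // i _.
have [le_Ni|lt_iN] := leqP N i; rewrite absM.
  have := HN i le_Ni; rewrite ltr_pdivlMr //; apply: le_lt_trans.
  by rewrite ler_wpM2l ?abs_ge0.
have le_M : (M <= n - i)%N by lia.
have := HM _ le_M; rewrite ltr_pdivlMr //; apply: le_lt_trans.
by rewrite mulrC ler_wpM2l ?abs_ge0.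
Qed.

Lemma vanishingX (f : fps K) k : vanishing f -> vanishing (f ^+ k).
Proof.
move=> cf; elim: k => [|k IHk]; last by rewrite exprS; apply: vanishingM.
by move=> e e0; exists 1%N => -[|n] // _; rewrite expr0 fps_oneE abs0.
Qed.

(** The (p-1)-st power of the n-th coefficient is at most (|c|^(p-1) p)^n, a geometric sequence of
    ratio less than 1. *)
Lemma vanishing_expo_linear c : abs c ^+ (p - 1) < abs p%:R ->
  vanishing (fps_expo (fps_linear c)).
Proof.
have p1_gt0 : (0 < p - 1)%N by rewrite subn_gt0 prime_gt1.
move=> ltc e e0; pose r := abs c ^+ (p - 1) * p%:R.
have r0 : 0 <= r by rewrite mulr_ge0 ?exprn_ge0 ?abs_ge0.
have r1 : r < 1 by rewrite -ltr_pdivlMr ?pR_gt0 // mul1r -abs_p.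
have [N HN] := expr_small r0 r1 (exprn_gt0 (p - 1) e0).
exists N => n /HN; rewrite expo_linearE => ltr.
rewrite -(ltr_pXn2r p1_gt0) ?nnegrE ?abs_ge0 ?(ltW e0) //.
apply: le_lt_trans ltr; rewrite abs_expo_linearX /r exprMn.
rewrite ler_wpM2l ?exprn_ge0 ?abs_ge0 //.
by rewrite ler_eXn2l ?pR_gt1 // (leq_trans (logn_fact_le n)) // leq_pred.
Qed.

(** At the indices n = p^k, the (p-1)-st power of the absolute value of the coefficient is exactly
    |p|. *)
Lemma not_vanishing_expo_linear c : abs c ^+ (p - 1) = abs p%:R ->
  ~ vanishing (fps_expo (fps_linear c)).
Proof.
have p1_gt0 : (0 < p - 1)%N by rewrite subn_gt0 prime_gt1.
move=> ec /(_ _ abs_p_gt0) [N HN].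
have := HN (p ^ N)%N (ltnW (ltn_expl N (prime_gt1 p_prime))).
rewrite expo_linearE; set x := abs _ => ltx.
have : x ^+ (p - 1) = abs p%:R.
  rewrite /x abs_expo_linearX ec logn_fact_expn abs_p exprVn.
  have : (0 < p ^ N)%N by rewrite expn_gt0 prime_gt0.
  case: (p ^ N)%N => // k _; rewrite exprS invfM -mulrA mulVf ?mulr1 //.
  by rewrite gt_eqF // exprn_gt0 // pR_gt0.
move=> ex; have := ltx; rewrite -ex ltNge; case/negP.
rewrite -(prednK p1_gt0) exprS ler_piMr ?abs_ge0 //.
by rewrite exprn_ile1 ?abs_ge0 // ltW // (lt_trans ltx) // abs_p_lt1.
Qed.

(** Roots of p of high order have absolute values increasing to 1. *)
Lemma exists_abs_near1 e : 0 < e -> exists t, 1 - e < abs t < 1.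
Proof.
move=> e0; pose r := Num.max (1 - e) 0.
have r0 : 0 <= r by rewrite le_max lexx orbT.
have r1 : r < 1 by rewrite gt_max ltr01 andbT; lra.
have [N HN] := expr_small r0 r1 abs_p_gt0; have := HN _ (leqnSn N).
have [t] := @solve_monicpoly K N.+1 (fun i => if i == 0%N then p%:R else 0) isT.
rewrite big_ord_recl expr0 mulr1 big1 ?addr0 => [et|i _]; last by rewrite mul0r.
rewrite -et absX => ltr; exists t; apply/andP; split.
  have : r < abs t by rewrite -(ltr_pXn2r (ltn0Sn N)) ?nnegrE ?abs_ge0.
  by apply: le_lt_trans; rewrite le_max lexx.
rewrite -(ltr_pXn2r (ltn0Sn N)) ?nnegrE ?abs_ge0 ?ler01 //.
by rewrite expr1n -absX et abs_p_lt1.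
Qed.

Lemma converges_at_vanishing (f : fps K) t : converges_at abs f t ->
  vanishing (fun n => f n * t ^+ n).
Proof.
move=> [y /abs_cvg_cauchy fy] e e0; have [N HN] := fy e e0.
exists N => n le_Nn; have := HN n.+1 n (leqW le_Nn) le_Nn.
by rewrite big_ord_recr /= addrAC subrr add0r.
Qed.

(** K is not complete, but the partial sums lie in the finite-dimensional space obtained by
    adjoining [t] to the span of the coefficients. *)
Lemma vanishing_converges_at s (f : fps K) t : is_subring (span Qp s) ->
    (forall n, span Qp s (f n)) -> vanishing (fun n => f n * t ^+ n) ->
  converges_at abs f t.
Proof.
move=> subs sf cf; have [s' [subs' ss' st _]] := span_adjoin t subs.
have [||y _ fy] := @span_complete s' (fun n => \sum_(i < n) f i * t ^+ i).
- move=> n; apply: (subring_sum subs') => i _; apply: (subringM subs').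
    exact: ss'.
  exact: (subringX subs').
- move=> e e0; have [N HN] := cf e e0; exists N.
  have tail m n : (N <= m <= n)%N ->
      abs (\sum_(i < n) f i * t ^+ i - \sum_(i < m) f i * t ^+ i) < e.
    move=> /andP [le_Nm le_mn].
    rewrite -!(big_mkord predT (fun i => f i * t ^+ i)).
    rewrite (big_cat_nat _ (n := m)) //= addrAC subrr add0r big_nat.
    by apply: abs_sum_lt => // i /andP [le_mi _]; apply: HN; apply: leq_trans le_mi.
  move=> m n le_Nm le_Nn; case/orP: (leq_total m n) => le_mn.
    by rewrite absBC tail // le_Nm.
  by rewrite tail // le_Nn.
- by exists y.
Qed.

(** Bounded coefficients give convergence for |t| < 1. Convergence at a single point with |t| >= 1
    makes the coefficients tend to 0, which conversely gives convergence on the whole closed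
    disk. *)
Lemma converges_exactlyP s (f : fps K) : is_subring (span Qp s) ->
    (forall n, span Qp s (f n)) -> (forall n, abs (f n) <= 1) ->
  converges_exactly_in_open_unit_disk abs f <-> ~ vanishing f.
Proof.
move=> subs sf f1.
have conv_open t : abs t < 1 -> converges_at abs f t.
  move=> t1; apply: (vanishing_converges_at subs sf) => e e0.
  have [N HN] := expr_small (abs_ge0 t) t1 e0; exists N => n /HN.
  by apply: le_lt_trans; rewrite absM absX ler_piMl // exprn_ge0 // abs_ge0.
have conv_vanish t : 1 <= abs t -> converges_at abs f t -> vanishing f.
  move=> t1 /converges_at_vanishing cf e e0; have [N HN] := cf e e0.
  exists N => n /HN; apply: le_lt_trans.
  by rewrite absM absX ler_peMr ?abs_ge0 // exprn_ege1.
split=> [[_ _ larger] cf|ncf].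
  apply: (larger (closed_disk abs 1)).
  - by exists 1; right.
  - split=> [t /ltW //|/(_ 1)]; rewrite /open_disk /closed_disk /= abs1 ltxx.
    by move=> /(_ (lexx _)).
  move=> t t1; apply: (vanishing_converges_at subs sf) => e e0.
  have [N HN] := cf e e0; exists N => n /HN; apply: le_lt_trans.
  by rewrite absM absX ler_piMr ?abs_ge0 // exprn_ile1 // abs_ge0.
split=> [t|| D [r Dr] [_ nDo] cD].
- exact: conv_open.
- apply/eqP; rewrite eq_le; apply/andP; split.
    apply: ge_ereal_sup => _ [t ct <-]; rewrite lee_fin leNgt; apply/negP => t1.
    by apply: ncf; apply: (conv_vanish t); first exact: ltW.
  (* The supremum 1 is not attained; it is approached by points of the open disk. *)
  apply/lee_addgt0Pr => e e0; have [t /andP [te t1]] := exists_abs_near1 e0.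
  have le_t : ((abs t)%:E <= radius_of_convergence abs f)%E.
    by apply: ereal_sup_ubound; exists t => //; exact: conv_open.
  apply: le_trans (leeD2r _ le_t); rewrite -EFinD lee_fin; lra.
apply: nDo => t Dt; rewrite /open_disk /= ltNge; apply/negP => t1.
by apply: ncf; apply: (conv_vanish t) => //; exact: cD.
Qed.

(** * Exact convergence and the Lubin-Tate condition *)

Section ExactDisk.
Variable P : fps K.
Hypotheses (P_int : integral_fps abs P) (P_0 : P 0%N = 0).
Hypothesis P_mod_p : fps_eqmod abs p%:R P (fps_Xn K p).
Variable varpi : nat -> K.
Hypothesis varpi_lt1 : forall j, abs (varpi j) < 1.
Hypothesis varpi_0 : fps_sum abs P (varpi 0%N) 0.
Hypothesis varpi_S : forall j, fps_sum abs P (varpi j.+1) (varpi j).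

Let E m : fps K := fps_expo (phantom_series p (phantom_of_seq varpi m)).

Lemma artin_hasse_exp_bracket m : artin_hasse_exp p (bracket varpi m) = E m.
Proof.
apply/funext => n; rewrite artin_hasse_exp_expo /E.
congr (fps_expo (phantom_series _ _) n).
by apply/funext => i; rewrite bracket_ghost.
Qed.

Lemma unit_ball_subring : is_subring (fun x => abs x <= 1).
Proof.
split=> [|x y x1 y1|x y x1 y1]; first by rewrite abs1.
  exact: absB_le.
by rewrite absM mulr_ile1 ?abs_ge0.
Qed.

(** The product form shows integrality: the Artin-Hasse series has coefficients in Z_p, and the
    components lie in Z_p[varpi_m], inside the unit ball. *)
Lemma artin_hasse_exp_bracket_le1 m n : abs (E m n) <= 1.
Proof.
rewrite -artin_hasse_exp_bracket /artin_hasse_exp fps_prodE.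
have ball_subring := unit_ball_subring.
apply: (subring_prod (fps_in_subring ball_subring)) => j _.
apply: (fps_comp_monomial_in _ ball_subring) => [|i].
  have [f Zf ->] := bracket_integral P_int P_0 P_mod_p varpi_0 varpi_S m j.
  apply: (horner_subring ball_subring) => [i|]; first by have [] := Zf i.
  exact: ltW.
by have [] := artin_hasse_integral i.
Qed.

Lemma converges_exactly_bracketP m :
  converges_exactly_in_open_unit_disk abs (artin_hasse_exp p (bracket varpi m)) <->
  ~ vanishing (E m).
Proof.
have [s [subs sm Qs _]] := adjoin_span (varpi m).
rewrite artin_hasse_exp_bracket; apply: (converges_exactlyP subs) => n.
  apply: (fps_expo_in subs Qs); apply: (phantom_series_in subs Qs).
  exact: (phantom_span P_int P_0 varpi_0 varpi_S subs Qs sm).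
exact: artin_hasse_exp_bracket_le1.
Qed.

Lemma vanishing_pred m : vanishing (E m.+1) -> vanishing (E m).
Proof.
have p_gt0 := prime_gt0 p_prime; move=> cE.
pose c := p%:R * varpi m.+1.
have shift : (fun i => phantom_of_seq varpi m.+1 i.+1) = phantom_of_seq varpi m.
  by apply/funext => i; rewrite /phantom_of_seq ltnS subSS.
have := expo_phantom_exp_p (phantom_of_seq varpi m.+1).
rewrite shift {2}/phantom_of_seq leq0n subn0 -/c -/(E m.+1) -/(E m) => eE.
(* Multiplying by exp(-cT) solves the relation for E_m(T^p). *)
have linV : fps_expo (fps_linear (- c)) * fps_expo (fps_linear c) = 1.
  rewrite -fps_expoD //; last exact: natK_neq0.
  rewrite -[RHS](fps_expo0 natK_neq0); congr fps_expo; apply/funext => i.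
  by rewrite fps_addE /fps_linear; case: eqP => _; rewrite ?addr0 // addNr.
have cV : vanishing (fps_expo (fps_linear (- c))).
  apply: vanishing_expo_linear; rewrite absN absM exprMn.
  have p1_gt0 : (0 < p - 1)%N by rewrite subn_gt0 prime_gt1.
  (* Strictness comes from |varpi_(m+1)| < 1, which matters when p = 2 and the exponent p - 1 is
     1. *)
  apply: (@le_lt_trans _ _ (abs p%:R * abs (varpi m.+1))); last first.
    by rewrite gtr_pMr ?abs_p_gt0.
  rewrite -exprMn -absM -(prednK p1_gt0) exprS ler_piMr ?abs_ge0 //.
  rewrite exprn_ile1 ?abs_ge0 //.
  by rewrite absM mulr_ile1 ?abs_ge0 // ltW ?abs_p_lt1.
have cC : vanishing (fps_comp_monomial (E m) 1 p).
  rewrite -[fps_comp_monomial _ _ _]mul1r -linV -mulrA -eE.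
  by apply: vanishingM => //; exact: vanishingX.
move=> e e0; have [N HN] := cC e e0; exists N => n le_Nn.
have := HN (n * p)%N (leq_trans le_Nn (leq_pmulr _ p_gt0)).
by rewrite /fps_comp_monomial dvdn_mull // mulnK // expr1n mulr1.
Qed.

Lemma exp_bracket0 : E 0 = fps_expo (fps_linear (varpi 0%N)).
Proof.
congr fps_expo; apply/funext => n; rewrite /fps_linear.
have [->|n1] := eqVneq n 1%N.
  by rewrite -(expn0 p) phantom_seriesX expn0 divr1.
have [[k e]|nX] := pselect (exists k, n = (p ^ k)%N); last first.
  by apply: phantom_series_neqX => k e; apply: nX; exists k.
rewrite e phantom_seriesX; case: k e => [|k] e; first by rewrite e eqxx in n1.
by rewrite mul0r.
Qed.

(** With u = varpi_0, all terms of P(u) = 0 other than P_1 u + u^p add up to at most |p||u|^2;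
    dividing by u leaves |p||u| < |p|. *)
Lemma abs_P1_varpi0 : varpi 0%N <> 0 ->
  abs (P 1%N + varpi 0%N ^+ (p - 1)) < abs p%:R.
Proof.
move=> /eqP u0; have p_gt1 := prime_gt1 p_prime; set u := varpi 0%N in u0 *.
have au0 : 0 < abs u by rewrite abs_gt0.
have [h Zh hP] := P_mod_p.
have e0 : 0 < abs p%:R * abs u ^+ 2 by rewrite mulr_gt0 ?abs_p_gt0 // exprn_gt0.
have [N HN] := (abs_cvgP _ _).1 varpi_0 _ e0.
(* The partial sum includes degree p and approximates 0 within |p||u|^2. After degrees 0 and 1 are
   split off, u^p sits at index p - 2. *)
pose M := (N + p)%N; have lt_pM : (p - 2 < M)%N by rewrite /M; lia.
have := HN M.+2; rewrite subr0 => /(_ _) /ltW small.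
have {}small : abs (\sum_(i < M.+2) P i * u ^+ i) <= abs p%:R * abs u ^+ 2.
  by apply: small; rewrite /M; lia.
have split_sum : \sum_(i < M.+2) P i * u ^+ i = P 1%N * u + u ^+ p +
    \sum_(i < M) p%:R * h i.+2 * u ^+ i.+2.
  rewrite !big_ord_recl /= P_0 mul0r add0r expr1 -addrA; congr (_ + _).
  have -> : u ^+ p = \sum_(i < M) (if i == Ordinal lt_pM then u ^+ i.+2 else 0).
    by rewrite -big_mkcond big_pred1_eq /= -[X in u ^+ X](subnK p_gt1) addn2.
  rewrite -big_split /=; apply: eq_bigr => i _; rewrite /bump /= !add1n -hP /fps_Xn.
  have -> : (i.+2 == p) = (i == Ordinal lt_pM).
    by rewrite -val_eqE /=; apply/eqP/eqP; lia.
  by case: ifP => _; rewrite mulrBl ?mul1r ?mul0r; ring.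
have tail : abs (\sum_(i < M) p%:R * h i.+2 * u ^+ i.+2) <= abs p%:R * abs u ^+ 2.
  apply: abs_sum_le => [|i _]; first exact: ltW.
  rewrite absM (absM p%:R) absX; apply: ler_pM.
  - by rewrite mulr_ge0 ?abs_ge0.
  - by rewrite exprn_ge0 ?abs_ge0.
  - by rewrite ler_piMr ?abs_ge0 //; have [] := Zh i.+2.
  - by apply: ler_wiXn2l => //; [exact: abs_ge0|exact: ltW (varpi_lt1 _)].
have : abs (P 1%N * u + u ^+ p) <= abs p%:R * abs u ^+ 2.
  rewrite -[P 1%N * u + _](addrK (\sum_(i < M) p%:R * h i.+2 * u ^+ i.+2)) -split_sum.
  exact: absB_le.
have -> : P 1%N * u + u ^+ p = (P 1%N + u ^+ (p - 1)) * u.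
  by rewrite mulrDl -exprSr subn1 prednK // ltnW.
rewrite absM expr2 mulrA ler_pM2r //; move=> /le_lt_trans; apply.
by rewrite gtr_pMr ?abs_p_gt0 //; exact: varpi_lt1.
Qed.

Lemma abs_P1_le : abs (P 1%N) <= abs p%:R.
Proof.
have [h Zh hP] := P_mod_p; have := hP 1%N.
rewrite /fps_Xn ltn_eqF ?prime_gt1 // subr0 => ->.
by rewrite absM ler_piMr ?abs_ge0 //; have [] := Zh 1%N.
Qed.

(** By [abs_P1_varpi0], |varpi_0|^(p-1) is below |p| or equal to |p| according as |P_1| is; larger
    values of |P_1| are excluded by [abs_P1_le]. *)
Lemma not_vanishing_exp_bracket0 : ~ vanishing (E 0) <->
  varpi 0%N <> 0 /\ abs (P 1%N) = abs p%:R.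
Proof.
have p1_gt0 : (0 < p - 1)%N by rewrite subn_gt0 prime_gt1.
rewrite exp_bracket0; split=> [nc|[u0 P1]].
  have u0 : varpi 0%N <> 0.
    move=> u0; apply: nc; apply: vanishing_expo_linear.
    by rewrite u0 abs0 expr0n gtn_eqF // abs_p_gt0.
  split=> //; apply/eqP; rewrite eq_le abs_P1_le leNgt; apply/negP => lt_P1.
  apply: nc; apply: vanishing_expo_linear; rewrite -absX.
  rewrite -[_ ^+ _](addKr (P 1%N)) addrC.
  by apply: absB_lt => //; exact: abs_P1_varpi0.
apply: not_vanishing_expo_linear; rewrite -absX -P1 -(absN (P 1%N)).
apply: abs_eq_of_lt; rewrite opprK addrC absN P1; exact: abs_P1_varpi0.
Qed.

(** The uniformizer can only be P_1. If |P_1| = |p|, the quotient p/P_1 is a unit of Z_p and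
    transfers the congruence from p to P_1. *)
Lemma lubin_tate_seriesP : lubin_tate_series abs p P <-> abs (P 1%N) = abs p%:R.
Proof.
split=> [[_ [w [_ ew [_ ->] _]]] //|P1]; split => //; exists (P 1%N); split => //.
have [h Zh hP] := P_mod_p.
have P1_neq0 : P 1%N != 0 by rewrite -abs_gt0 P1 abs_p_gt0.
exists (fun n => h n * (p%:R / P 1%N)) => n; last first.
  by rewrite hP; field.
apply: (subringM Zp_subring) => //; split.
  by apply: QpM; [exact: Qp_nat|apply: QpV; have [] := P_int 1%N].
by rewrite absM absV P1 divff // gt_eqF ?abs_p_gt0.
Qed.

Lemma tate_generatorP : tate_generator abs P varpi <-> varpi 0%N <> 0.
Proof. by split=> [[]|]. Qed.

Lemma exact_disk_lubin_tate :
  (forall m, converges_exactly_in_open_unit_disk abs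
               (artin_hasse_exp p (bracket varpi m))) <->
  lubin_tate_series abs p P /\ tate_generator abs P varpi.
Proof.
split=> [exact_E|[/lubin_tate_seriesP P1 /tate_generatorP u0] m].
  have /not_vanishing_exp_bracket0 [u0 P1] :=
    (converges_exactly_bracketP 0).1 (exact_E 0%N).
  by split; [apply/lubin_tate_seriesP|apply/tate_generatorP].
apply/converges_exactly_bracketP => cE.
suff : vanishing (E 0) by apply/not_vanishing_exp_bracket0.
by elim: m cE => // m IHm /vanishing_pred.
Qed.

(** Each component is determined by its phantom component and the earlier components, since p^n is
    nonzero in K. *)
Lemma bracket_unique m : unique (witt_bracket abs p varpi m) (bracket varpi m).
Proof.
split=> [|lambda [_ gh]].
  split=> [j|n]; last exact: bracket_ghost.
  exact: (bracket_integral P_int P_0 P_mod_p varpi_0 varpi_S).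
apply/funext; elim/ltn_ind => n IHn.
have := bracket_ghost varpi m n.
rewrite -gh /witt_phantom !big_ord_recr /= subnn !expr1.
rewrite (eq_bigr (fun i : 'I_n => p%:R ^+ i * lambda i ^+ (p ^ (n - i)))) => [|i _].
  by move=> /addrI /(mulfI (pXK_neq0 n)).
by rewrite IHn.
Qed.

End ExactDisk.

End QpAlg.

Theorem proposition2p12
  (p : nat) (p_prime : prime p)
  (R : realType) (K : closedFieldType) (abs : K -> R)
  (K_Qp_alg : Qp_alg abs p)
  (P : fps K) (P_int : integral_fps abs P) (P_0 : P 0%N = 0)
  (P_mod_p : fps_eqmod abs p%:R P (fps_Xn K p))
  (varpi : nat -> K)
  (varpi_lt1 : forall j : nat, abs (varpi j) < 1)
  (varpi_0 : fps_sum abs P (varpi 0%N) 0)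
  (varpi_S : forall j : nat, fps_sum abs P (varpi j.+1) (varpi j)) :
  exists bracket : nat -> (nat -> K),
    [/\ forall m : nat, unique (witt_bracket abs p varpi m) (bracket m),
        forall m n : nat,
          artin_hasse_exp p (bracket m) n =
          fps_expo (phantom_series p (phantom_of_seq varpi m)) n
      & (forall m : nat,
           converges_exactly_in_open_unit_disk abs
             (artin_hasse_exp p (bracket m)))
        <->
        (lubin_tate_series abs p P /\ tate_generator abs P varpi)].
Proof.
exists (bracket p varpi); split=> [m|m n|].
- exact: (bracket_unique p_prime K_Qp_alg P_int P_0 P_mod_p varpi_0 varpi_S).
- by rewrite (artin_hasse_exp_bracket p_prime K_Qp_alg).
- exact: (exact_disk_lubin_tate p_prime K_Qp_alg P_int P_0 P_mod_p varpi_lt1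
    varpi_0 varpi_S).
Qed.
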